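(* Assume that $f,g\in L^1(\mathbb R^3)\cap L^2(\mathbb R^3)$, and that $f$ is supported in $\{|\bar x|\geq \gamma_2R\}$ while $g$ is supported in $\{|\bar x|\leq \gamma_1R\}$, for some positive parameters $\gamma_1,\gamma_2$ satisfying $d:=\gamma_2-\gamma_1>0$. Then $$|\langle \mathcal R_i^4f,g\rangle|\lesssim R^{-1}\|g\|_{L^1}\|f\|_{L^1}.$$
   Context: All functions are defined on $\mathbb R^3$. For $x=(x_1,x_2,x_3)\in\mathbb R^3$, write $\bar x=(x_1,x_2)$ and $|\bar x|=(x_1^2+x_2^2)^{1/2}$. $R>0$ is the parameter fixing the radii of the cylinders. $\langle\cdot,\cdot\rangle$ is the usual $L^2(\mathbb R^3)$ inner product. $\mathcal R_i$, $i\in\{1,2,3\}$, is the $i$-th Riesz transform on $\mathbb R^3$, and $\mathcal R_i^4$ is its fourth power, i.e. the Fourier multiplier operator with symbol $\xi_i^4/|\xi|^4$. The symbol $\lesssim$ denotes inequality up to a positive multiplicative constant.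
   Formalization: The bound is proved with one constant (depending on d and r0) for all R ≥ r0, for every r0 > 0; with a constant uniform over all R > 0 it fails as R → 0, since by dilation the pairing scales like R^{-3}. *)

(* Defs.v *)
From HB Require Import structures.
From mathcomp Require Import all_boot all_order all_algebra.
From mathcomp Require Import all_classical all_reals all_analysis.
From mathcomp.real_closed Require Export complex.
Set Implicit Arguments.
Unset Strict Implicit.
Unset Printing Implicit Defensive.
Import Order.TTheory GRing.Theory Num.Theory.
Import numFieldNormedType.Exports.
Local Open Scope classical_set_scope.
Local Open Scope complex_scope.
Local Open Scope ring_scope.

Notation cmod := ComplexField.Normc.normc.

(* R^3 with its product sigma-algebra; x = (x_1, x_2, x_3) is
   (x.1.1, x.1.2, x.2). *)
Notation space3 R :=
  (measurableTypeR R * measurableTypeR R * measurableTypeR R)%type.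

Section Space.
Variable R : realType.

Definition leb3 : {measure set (space3 R) -> \bar R} :=
  ((@lebesgue_measure R \x @lebesgue_measure R) \x @lebesgue_measure R)%E.

(* The index i : 'I_3 stands for the coordinate number i + 1. *)
Definition coord3 (i : 'I_3) (x : space3 R) : R :=
  match val i with
  | 0%N => x.1.1
  | 1%N => x.1.2
  | _ => x.2
  end.

Definition dot3 (x y : space3 R) : R := \sum_(i < 3) coord3 i x * coord3 i y.

Definition norm3 (x : space3 R) : R := Num.sqrt (\sum_(i < 3) coord3 i x ^+ 2).

Definition norm_bar (x : space3 R) : R := Num.sqrt (x.1.1 ^+ 2 + x.1.2 ^+ 2).

Definition normLp (p : \bar R) (f : space3 R -> R[i]) : \bar R :=
  Lnorm leb3 p (fun x => (cmod (f x))%:E).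

(* Membership in L^p; functions are not quotiented by a.e. equality. *)
Definition inLp (p : \bar R) (f : space3 R -> R[i]) : Prop :=
  [/\ measurable_fun [set: space3 R] (fun x => complex.Re (f x)),
      measurable_fun [set: space3 R] (fun x => complex.Im (f x)) &
      (normLp p f < +oo)%E].

(* The support of an element of L^p is its essential support: for A closed,
   it lies in A iff f vanishes almost everywhere off A. *)
Definition supported_in (A : set (space3 R)) (f : space3 R -> R[i]) : Prop :=
  {ae leb3, forall x, ~ A x -> f x = 0}.

Definition cint3 (f : space3 R -> R[i]) : R[i] :=
  (\int[leb3]_x complex.Re (f x)) +i* (\int[leb3]_x complex.Im (f x)).

Definition innerL2 (f g : space3 R -> R[i]) : R[i] :=
  cint3 (fun x => f x * ((g x)^*)%C).

Definition character3 (xi x : space3 R) : R[i] :=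
  let t := 2 * pi * dot3 x xi in cos t -i* sin t.

Definition fourierL1 (f : space3 R -> R[i]) (xi : space3 R) : R[i] :=
  cint3 (fun x => character3 xi x * f x).

(* F is (a representative of) the Fourier-Plancherel transform of f in L^2,
   i.e. of the L^2-continuous extension of the integral transform from
   the intersection of L^1 and L^2. *)
Definition is_fourierL2 (f F : space3 R -> R[i]) : Prop :=
  [/\ inLp 2 f, inLp 2 F &
   exists u : nat -> space3 R -> R[i],
   [/\ forall n, inLp 1 (u n) /\ inLp 2 (u n),
       (fun n => normLp 2 (fun x => u n x - f x)) @ \oo --> 0%E &
       (fun n => normLp 2 (fun xi => fourierL1 (u n) xi - F xi)) @ \oo
         --> 0%E]].

(* h is (a representative of) the image of f in L^2 under the Fourier
   multiplier operator with symbol m. *)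
Definition is_fourier_multiplier (m : space3 R -> R[i])
    (f h : space3 R -> R[i]) : Prop :=
  exists F H : space3 R -> R[i],
  [/\ is_fourierL2 f F, is_fourierL2 h H &
      {ae leb3, forall xi, H xi = m xi * F xi}].

Definition riesz4_symbol (i : 'I_3) (xi : space3 R) : R[i] :=
  (coord3 i xi ^+ 4 / norm3 xi ^+ 4)%:C.

(* h = R_i^4 f, the fourth power of the i-th Riesz transform. *)
Definition is_riesz4 (i : 'I_3) (f h : space3 R -> R[i]) : Prop :=
  is_fourier_multiplier (riesz4_symbol i) f h.

End Space.

(* Main.v *)
Require Import Defs.
From HB Require Import structures.
From mathcomp Require Import all_boot all_order all_algebra.
From mathcomp Require Import all_classical all_reals all_analysis.
From mathcomp Require Import measurable_realfun.
From mathcomp Require Import ring lra.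
Set Implicit Arguments.
Unset Strict Implicit.
Unset Printing Implicit Defensive.
Import Order.TTheory GRing.Theory Num.Theory.
Import numFieldNormedType.Exports.
Local Open Scope classical_set_scope.
Local Open Scope complex_scope.
Local Open Scope ring_scope.

(** Write m for the symbol xi_i ^ 4 / |xi| ^ 4. Formally, R_i ^ 4 f is the
    convolution of f with a kernel homogeneous of degree - 3, so where the
    distance to the support of f is at least d r it is at most a constant times
    (d r) ^ (- 3) times the L1 norm of f, and r >= r0 turns r ^ (- 3) into
    r ^ (- 1). The proof gives a meaning to this pointwise bound without
    constructing the singular kernel.

    The function h = R_i ^ 4 f is tested against heat kernels centred at a point
    y of the cylinder that carries g. The multiplication formula
    (integral of F w = integral of f w^), a consequence of Fubini's theorem that
    extends to L2 by continuity ([fourierL2_multiplication]), transports the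
    pairing to the Fourier side, where h becomes m times the transform of f.
    There

      m (xi) = \int_0^oo s xi_i ^ 4 exp (- s |xi| ^ 2) ds

    ([rsymbol_superposition]). The transform of
    xi_i ^ 4 exp (- (s + a) |xi| ^ 2) is an explicit Gaussian with a Hermite
    factor ([cosmom0E], [cosmom4E]). Away from the origin it decays fast enough,
    as s + a tends to 0 and to infinity, for the integral in s to converge
    uniformly in a > 0 ([kap400_bound]). Going back with the multiplication
    formula, the average of h against every heat kernel centred in the cylinder
    is bounded by B = O(r ^ (- 1)) times the L1 norm of f
    ([riesz4_heat_bound]).

    Since heat kernels form an approximate identity, this bound passes to h
    itself almost everywhere on the cylinder ([heat_bound_ae]). The convergence
    needed is that of 1_E * heat to 1_E in L2 for bounded measurable E. It
    reduces to the convergence of the overlaps \int_E 1_E * heat to |E|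
    ([avg_sqr_distance], [overlap_cvg]), which is clear with a set of negligible
    boundary in place of one of the two E's and follows in general from a
    pi-lambda argument ([dominated_setwise_cvg]).

    Finally |<h, g>| is at most the integral of |h| |g| over the cylinder. All
    integrals are reduced to real ones through [rot], the real part of a complex
    number turned by a given angle. *)

(** * Product measures *)

Section product_sigma_finite.
Local Open Scope ereal_scope.
Context d1 d2 (T1 : measurableType d1) (T2 : measurableType d2) (R : realType).
Variable m1 : {sigma_finite_measure set T1 -> \bar R}.
Variable m2 : {sigma_finite_measure set T2 -> \bar R}.

(** A named product can carry a sigma-finite structure, so that products, and
    with them Fubini's theorem, iterate. *)
Definition prodm : set (T1 * T2) -> \bar R := m1 \x m2.

HB.instance Definition _ := Measure.copy prodm (m1 \x m2).

Let prodm_sigma_finite : sigma_finite setT prodm.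
Proof.
have /sigma_finiteP[F [TF ndF Foo]] := sigma_finiteT m1.
have /sigma_finiteP[G [TG ndG Goo]] := sigma_finiteT m2.
exists (fun n => F n `*` G n).
  rewrite -setXTT TF TG predeqE => -[x y]; split.
    move=> [/= [n _ Fnx] [k _ Gky]]; exists (maxn n k) => //; split.
    - by move: x Fnx; exact/subsetPset/ndF/leq_maxl.
    - by move: y Gky; exact/subsetPset/ndG/leq_maxr.
  by move=> [n _ []/= ? ?]; split; exists n.
move=> k; have [? ?] := Foo k; have [? ?] := Goo k.
split; first exact: measurableX.
by rewrite /prodm product_measure1E// lte_mul_pinfty// ge0_fin_numE.
Qed.

HB.instance Definition _ := Measure_isSigmaFinite.Build _ _ _ prodm
  prodm_sigma_finite.

End product_sigma_finite.

(** * Integrals of real-valued functions *)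

Section real_integrals.
Context d (T : measurableType d) (R : realType).
Variable mu : {measure set T -> \bar R}.
Implicit Types f g : T -> R.

Lemma integrable_measurable f :
  mu.-integrable setT (EFin \o f) -> measurable_fun setT f.
Proof. by move=> /measurable_int/measurable_EFinP. Qed.

Lemma le_integrableR f g : measurable_fun setT f ->
  (forall x, `|f x| <= g x) -> mu.-integrable setT (EFin \o g) ->
  mu.-integrable setT (EFin \o f).
Proof.
move=> mf fg ig; apply: le_integrable ig => //; first exact/measurable_EFinP.
move=> x _ /=; rewrite lee_fin (le_trans (fg x))//.
by rewrite ger0_norm// (le_trans _ (fg x)).
Qed.

Lemma integrable_normr f : mu.-integrable setT (EFin \o f) ->
  mu.-integrable setT (EFin \o (fun x => `|f x|)).
Proof.
move=> /[dup] /integrable_measurable mf; apply: le_integrable => //.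
  by apply/measurable_EFinP; exact: measurableT_comp.
by move=> x _ /=; rewrite normr_id.
Qed.

Lemma integrable_scale (k : R) f : mu.-integrable setT (EFin \o f) ->
  mu.-integrable setT (EFin \o (fun x => k * f x)).
Proof. by move=> /(integrableZl measurableT k). Qed.

Lemma integrable_add f g : mu.-integrable setT (EFin \o f) ->
  mu.-integrable setT (EFin \o g) ->
  mu.-integrable setT (EFin \o (fun x => f x + g x)).
Proof. by move=> i1 i2; have := integrableD measurableT i1 i2. Qed.

Lemma integrable_sub f g : mu.-integrable setT (EFin \o f) ->
  mu.-integrable setT (EFin \o g) ->
  mu.-integrable setT (EFin \o (fun x => f x - g x)).
Proof. by move=> i1 i2; have := integrableB measurableT i1 i2. Qed.

Lemma integrable_mul_bounded (k : R) f g : measurable_fun setT g ->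
  (forall x, `|g x| <= k) -> mu.-integrable setT (EFin \o f) ->
  mu.-integrable setT (EFin \o (fun x => f x * g x)).
Proof.
move=> mg gk fi; have mf := integrable_measurable fi.
apply: (@le_integrableR _ (fun x => k * `|f x|)).
- exact: measurable_funM.
- by move=> x; rewrite normrM mulrC ler_wpM2r.
- exact/integrable_scale/integrable_normr.
Qed.

Lemma EFin_Rintegral f : mu.-integrable setT (EFin \o f) ->
  (\int[mu]_x f x)%R%:E = (\int[mu]_x (f x)%:E)%E.
Proof. by move=> fi; rewrite /Rintegral fineK// integrable_fin_num. Qed.

Lemma ler_norm_Rintegral f g : measurable_fun setT f ->
  mu.-integrable setT (EFin \o g) ->
  (forall x, `|f x| <= g x) -> `|\int[mu]_x f x| <= \int[mu]_x g x.
Proof.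
move=> mf gi fg; have fi := le_integrableR mf fg gi.
apply: (le_trans (le_normr_Rintegral _ _)) => //.
by apply: le_Rintegral => //; exact: integrable_normr.
Qed.

Lemma ae_eq_Rintegral f g : measurable_fun setT f -> measurable_fun setT g ->
  {ae mu, forall x, f x = g x} -> \int[mu]_x f x = \int[mu]_x g x.
Proof.
move=> mf mg fg; congr fine; apply: ae_eq_integral => //.
- exact/measurable_EFinP.
- exact/measurable_EFinP.
- by apply: filterS fg => x /= -> _.
Qed.

Lemma ae_eq_integrable f g : measurable_fun setT g ->
  {ae mu, forall x, f x = g x} -> mu.-integrable setT (EFin \o f) ->
  mu.-integrable setT (EFin \o g).
Proof.
move=> mg fg /integrableP[mf fi]; apply/integrableP; split.
  exact/measurable_EFinP.
rewrite (_ : (\int[mu]_x _)%E = (\int[mu]_x `|(EFin \o f) x|)%E)//.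
apply: ae_eq_integral => //.
- by apply: measurableT_comp => //; exact/measurable_EFinP.
- exact: measurableT_comp.
- by apply: filterS fg => x /= -> _.
Qed.

(** Young's inequality turns square integrability into integrability of
    products. *)
Lemma integrable_mul_sqr f g : measurable_fun setT f -> measurable_fun setT g ->
  mu.-integrable setT (EFin \o (fun x => f x ^+ 2)) ->
  mu.-integrable setT (EFin \o (fun x => g x ^+ 2)) ->
  mu.-integrable setT (EFin \o (fun x => f x * g x)).
Proof.
move=> mf mg fi gi.
apply: (@le_integrableR _ (fun x => f x ^+ 2 + g x ^+ 2)).
- exact: measurable_funM.
- move=> x; rewrite normrM -(real_normK (num_real (f x))).
  rewrite -(real_normK (num_real (g x))).
  by have := sqr_ge0 (`|f x| - `|g x|); have := sqr_ge0 (`|f x| + `|g x|); nra.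
- exact: integrable_add.
Qed.

(** The integral of (f + t g) ^ 2 is a quadratic polynomial in t that never
    becomes negative. *)
Lemma Rintegral_cauchy_schwarz f g :
  measurable_fun setT f -> measurable_fun setT g ->
  mu.-integrable setT (EFin \o (fun x => f x ^+ 2)) ->
  mu.-integrable setT (EFin \o (fun x => g x ^+ 2)) ->
  (\int[mu]_x (f x * g x)) ^+ 2 <=
  (\int[mu]_x (f x ^+ 2)) * (\int[mu]_x (g x ^+ 2)).
Proof.
move=> mf mg fi gi; have fgi := integrable_mul_sqr mf mg fi gi.
set A := \int[mu]_x (f x ^+ 2); set B := \int[mu]_x (g x ^+ 2).
set C := \int[mu]_x (f x * g x).
have quad t : 0 <= A + (2 * t) * C + t ^+ 2 * B.
  rewrite /A /B /C -RintegralZl// -RintegralZl//.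
  rewrite -RintegralD//; last exact: integrable_scale.
  rewrite -RintegralD//; [|by apply: integrable_add => //;
    exact: integrable_scale|exact: integrable_scale].
  apply: Rintegral_ge0 => x _.
  rewrite (_ : _ + _ = (f x + t * g x) ^+ 2) ?sqr_ge0//; ring.
have A0 : 0 <= A by apply: Rintegral_ge0 => x _; exact: sqr_ge0.
have B0 : 0 <= B by apply: Rintegral_ge0 => x _; exact: sqr_ge0.
have [B00|Bn0] := eqVneq B 0.
  rewrite B00 mulr0; have [->|Cn0] := eqVneq C 0; first by rewrite expr0n.
  (* with B = 0 the quadratic is affine in t, and negative at this t *)
  have := quad (- (A + 1) / (2 * C)); rewrite B00 mulr0 addr0.
  have -> : 2 * (- (A + 1) / (2 * C)) * C = - (A + 1) by field.
  by lra.
have := quad (- C / B).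
have -> : A + 2 * (- C / B) * C + (- C / B) ^+ 2 * B = A - C ^+ 2 / B by field.
by rewrite subr_ge0 ler_pdivrMr// lt0r Bn0.
Qed.

Lemma ae_ler_norm_Rintegral f g : measurable_fun setT f ->
  mu.-integrable setT (EFin \o g) ->
  {ae mu, forall x, `|f x| <= g x} ->
  mu.-integrable setT (EFin \o f) /\ `|\int[mu]_x f x| <= \int[mu]_x g x.
Proof.
move=> mf gi fg; have mg := integrable_measurable gi.
(* cutting f off at height g changes it on a null set only *)
pose f' x := Num.max (- `|g x|) (Num.min `|g x| (f x)).
have mf' : measurable_fun setT f'.
  have mng : measurable_fun setT (fun x => `|g x|) by exact: measurableT_comp.
  apply: measurable_maxr; first exact: measurableT_comp.
  exact: measurable_minr.
have ff' : {ae mu, forall x, f' x = f x}.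
  apply: filterS fg => x fgx; rewrite /f'.
  have := le_trans fgx (ler_norm _); rewrite ler_norml => /andP[h1 h2].
  by rewrite min_r ?max_r.
have gE : {ae mu, forall x, `|g x| = g x}.
  by apply: filterS fg => x fgx; rewrite ger0_norm// (le_trans _ fgx).
have f'g x : `|f' x| <= `|g x|.
  rewrite /f' ler_norml le_max lexx/= ge_max ge_min lexx/= andbT.
  by rewrite lerNl (le_trans _ (normr_ge0 _))// oppr_le0.
have gi' := integrable_normr gi.
split; first exact: ae_eq_integrable ff' (le_integrableR mf' f'g gi').
rewrite -(ae_eq_Rintegral mf' mf ff').
rewrite -(ae_eq_Rintegral _ mg gE); last exact: measurableT_comp.
exact: ler_norm_Rintegral.
Qed.

End real_integrals.

Section fubini_real.
Context d1 d2 (T1 : measurableType d1) (T2 : measurableType d2) (R : realType).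
Variable m1 : {sigma_finite_measure set T1 -> \bar R}.
Variable m2 : {sigma_finite_measure set T2 -> \bar R}.

Lemma measurable_fun_Rintegral (f : T1 * T2 -> R) : measurable_fun setT f ->
  measurable_fun setT (fun x => \int[m2]_y f (x, y)).
Proof.
move=> mf; have mEf : measurable_fun setT (EFin \o f) by exact/measurable_EFinP.
apply: measurableT_comp => //.
rewrite (_ : (fun x => _) = (fun x => (\int[m2]_y (EFin \o f)^\+ (x, y)) -
    \int[m2]_y (EFin \o f)^\- (x, y))%E).
  apply: emeasurable_funB.
  - by apply: measurable_fun_fubini_tonelli_F => //; exact: measurable_funepos.
  - by apply: measurable_fun_fubini_tonelli_F => //; exact: measurable_funeneg.
apply/funext => x; rewrite [LHS]integralE.
under eq_integral do rewrite (funepos_comp (EFin \o f) (pair x))/=.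
by under [X in (_ - X)%E = _]eq_integral do
  rewrite (funeneg_comp (EFin \o f) (pair x))/=.
Qed.

Lemma integrable_prod_abs (f : T1 * T2 -> R) (g : T1 -> R) :
  measurable_fun setT f ->
  (forall x, m2.-integrable setT (fun y => (f (x, y))%:E)) ->
  (forall x, \int[m2]_y `|f (x, y)| <= g x) ->
  m1.-integrable setT (EFin \o g) ->
  (prodm m1 m2).-integrable setT (EFin \o f).
Proof.
move=> mf fi fg gi; apply/integrable12ltyP; first exact/measurable_EFinP.
move/integrableP : (gi) => [_]; apply: le_lt_trans.
apply: ge0_le_integral => //.
- by move=> x _; exact: integral_ge0.
- apply: (measurable_fun_fubini_tonelli_F (fun z => (`|(f z)%:E|)%E)) => //.
  by apply: measurableT_comp => //; exact/measurable_EFinP.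
- by apply: measurableT_comp => //; exact: measurable_int gi.
move=> x _; have := fg x; rewrite -lee_fin EFin_Rintegral; last first.
  exact: (integrable_normr (fi x)).
by move=> /le_trans; apply => /=; rewrite lee_fin ler_norm.
Qed.

Lemma integrable_tensor (f : T1 -> R) (g : T2 -> R) :
  m1.-integrable setT (EFin \o f) -> m2.-integrable setT (EFin \o g) ->
  (prodm m1 m2).-integrable setT (EFin \o (fun z => f z.1 * g z.2)).
Proof.
move=> fi gi; have mf := integrable_measurable fi.
have mg := integrable_measurable gi.
apply: (@integrable_prod_abs _ (fun x => `|f x| * \int[m2]_y `|g y|)) => /=.
- by apply: measurable_funM; apply: measurableT_comp.
- by move=> x; exact: integrable_scale.
- move=> x; under eq_Rintegral do rewrite normrM.
  by rewrite RintegralZl//; exact: integrable_normr.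
- rewrite (_ : _ \o _ = EFin \o
     (fun x => (\int[m2]_y `|g y|) * `|f x|)); last first.
    by apply/funext => x/=; rewrite mulrC.
  exact/integrable_scale/integrable_normr.
Qed.

Lemma Fubini1_real (f : T1 * T2 -> R) :
  (prodm m1 m2).-integrable setT (EFin \o f) ->
  \int[prodm m1 m2]_z f z = \int[m1]_x \int[m2]_y f (x, y).
Proof.
move=> fi; rewrite {1}/Rintegral -[X in fine X]integral12_prod_meas1//.
rewrite [RHS]/Rintegral; congr fine; apply: ae_eq_integral => //.
- exact: (measurable_fubini_F fi).
- apply/measurable_EFinP/measurable_fun_Rintegral.
  exact: integrable_measurable fi.
- have := ae_integrable1 fi; apply: filterS => x fxi _.
  by rewrite /fubini_F/= EFin_Rintegral.
Qed.

Lemma integrable_fubini_real (f : T1 * T2 -> R) :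
  (prodm m1 m2).-integrable setT (EFin \o f) ->
  m1.-integrable setT (EFin \o (fun x => \int[m2]_y f (x, y))).
Proof.
move=> fi; have := integrable_fubini_F fi.
have mF : measurable_fun setT (fun x => \int[m2]_y f (x, y)).
  by apply: measurable_fun_Rintegral; exact: integrable_measurable fi.
move=> /integrableP[mF' Fi]; apply/integrableP; split.
  exact/measurable_EFinP.
rewrite (_ : (\int[m1]_x _)%E = (\int[m1]_x `|fubini_F m2 (EFin \o f) x|)%E)//.
apply: ae_eq_integral => //.
- by apply: measurableT_comp => //; exact/measurable_EFinP.
- exact: measurableT_comp.
- have := ae_integrable1 fi; apply: filterS => x fxi _.
  by congr (`|_|)%E; exact: EFin_Rintegral fxi.
Qed.

End fubini_real.

Section fubini_real_swap.
Context d1 d2 (T1 : measurableType d1) (T2 : measurableType d2) (R : realType).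
Variable m1 : {sigma_finite_measure set T1 -> \bar R}.
Variable m2 : {sigma_finite_measure set T2 -> \bar R}.

Lemma Fubini_real (f : T1 * T2 -> R) :
  (prodm m1 m2).-integrable setT (EFin \o f) ->
  \int[m1]_x \int[m2]_y f (x, y) = \int[m2]_y \int[m1]_x f (x, y).
Proof.
move=> fi; have mf := integrable_measurable fi.
have mf' : measurable_fun setT (fun z : T2 * T1 => f (z.2, z.1)).
  by apply: (measurableT_comp mf); apply: measurable_fun_pair.
rewrite -Fubini1_real// /Rintegral -[X in fine X]integral21_prod_meas1//.
congr fine; apply: ae_eq_integral => //.
- exact: (measurable_fubini_G fi).
- apply/measurable_EFinP.
  exact: (@measurable_fun_Rintegral _ _ _ _ _ m1 (fun z => f (z.2, z.1))).
- have := ae_integrable2 fi; apply: filterS => x fxi _.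
  by rewrite /fubini_G/= EFin_Rintegral.
Qed.

End fubini_real_swap.

(** * Cosine integrals with a free phase *)

Lemma measurable_cos (R : realType) : measurable_fun setT (@cos R).
Proof. by apply: continuous_measurable_fun => x; exact: continuous_cos. Qed.

Section phase_integral.
Context d (T : measurableType d) (R : realType).
Variable mu : {measure set T -> \bar R}.

(** The free phase phi encodes at once the value of the cosine integral
    (phi = 0) and the vanishing of the sine integral (phi = - pi / 2). In this
    form the property passes to products, where the addition formulas mix
    sines and cosines. *)
Definition phase_integral (w th : T -> R) (a : R) : Prop :=
  [/\ mu.-integrable setT (EFin \o w), measurable_fun setT th &
      forall phi, \int[mu]_x (w x * cos (th x + phi)) = cos phi * a].

Lemma integrable_mul_cos (w th : T -> R) phi :
  mu.-integrable setT (EFin \o w) -> measurable_fun setT th ->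
  mu.-integrable setT (EFin \o (fun x => w x * cos (th x + phi))).
Proof.
move=> wi mth; apply: (@integrable_mul_bounded _ _ _ _ 1) => //.
- by apply: (measurableT_comp (@measurable_cos R)); exact: measurable_funD.
- by move=> x; exact: cos_max.
Qed.

End phase_integral.

Section phase_integral_prod.
Context d1 d2 (T1 : measurableType d1) (T2 : measurableType d2) (R : realType).
Variable m1 : {sigma_finite_measure set T1 -> \bar R}.
Variable m2 : {sigma_finite_measure set T2 -> \bar R}.

(** Integrating one variable first turns the phase of the other factor into a
    phase parameter, so that no trigonometric expansion is needed. *)
Lemma phase_integral_prod (w1 th1 : T1 -> R) (w2 th2 : T2 -> R) (a1 a2 : R) :
  phase_integral m1 w1 th1 a1 -> phase_integral m2 w2 th2 a2 ->
  phase_integral (prodm m1 m2) (fun z => w1 z.1 * w2 z.2)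
    (fun z => th1 z.1 + th2 z.2) (a1 * a2).
Proof.
move=> [w1i mth1 e1] [w2i mth2 e2].
have wi := integrable_tensor w1i w2i.
have mth : measurable_fun setT (fun z : T1 * T2 => th1 z.1 + th2 z.2).
  by apply: measurable_funD; apply: measurableT_comp.
split => // phi.
rewrite Fubini1_real; last exact: integrable_mul_cos.
under eq_Rintegral => x _ /=.
  under eq_Rintegral do rewrite -mulrA (addrC (th1 x)) -addrA.
  rewrite RintegralZl//; last exact: integrable_mul_cos.
  rewrite e2 mulrA; over.
rewrite RintegralZr//; last exact: integrable_mul_cos.
by rewrite e1 mulrA.
Qed.

End phase_integral_prod.

(** * Gaussian moments in one variable *)

(** The integral over [- n, n] is F n - F (- n), which is at most 2 C / n. *)
Lemma integral_derivative0 (R : realType) (F f : R -> R) (C : R) :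
  (forall x : R, is_derive x 1 F (f x)) -> continuous f ->
  (@lebesgue_measure R).-integrable setT (EFin \o f) ->
  (forall x, `|x| * `|F x| <= C) ->
  \int[@lebesgue_measure R]_x f x = 0.
Proof.
move=> dF cf fi FC; set mu := @lebesgue_measure R.
have mf := integrable_measurable fi.
have FTC (n : nat) : \int[mu]_(x in `[- n.+1%:R, n.+1%:R]) f x =
    F n.+1%:R - F (- n.+1%:R).
  rewrite /Rintegral (@continuous_FTC2 _ f F) //.
  - by rewrite gtrN ?ltr0n.
  - exact/continuous_subspaceT.
  - have cF : continuous F.
      move=> x; apply/differentiable_continuous/derivable1_diffP.
      by have [] := dF x.
    split => //.
    + exact/cvg_at_right_filter/cF.
    + exact/cvg_at_left_filter/cF.
  - by move=> x _; rewrite derive1E derive_val.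
have cvgI : \int[mu]_(x in `[- n.+1%:R, n.+1%:R]) f x @[n --> \oo] -->
    \int[mu]_x f x.
  apply: fine_cvg; rewrite EFin_Rintegral//.
  under eq_fun do rewrite integral_mkcond.
  have := @dominated_convergence _ _ _ mu setT measurableT
    (fun n : nat => (EFin \o f) \_ `[- n.+1%:R, n.+1%:R]) (EFin \o f)
    (EFin \o (fun x => `|f x|)).
  case => //.
  - move=> n; apply/(measurable_restrictT _ _).1 => //.
    by apply: measurable_funTS; exact/measurable_EFinP.
  - exact/measurable_EFinP.
  - apply: aeW => x _; apply: cvg_near_cst; near=> n.
    rewrite patchE mem_set//= in_itv/= -ler_norml.
    rewrite (@le_trans _ _ n%:R)// ?ler_nat//; near: n.
    exact: nbhs_infty_ger.
  - exact: integrable_normr.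
  - apply: aeW => x n _; rewrite patchE; case: ifPn => _ //=.
    by rewrite normr0 lee_fin.
have cvg0 : \int[mu]_(x in `[- n.+1%:R, n.+1%:R]) f x @[n --> \oo] --> (0 : R).
  under eq_fun do rewrite FTC.
  apply: norm_cvg0.
  apply: (@squeeze_cvgr _ _ _ _ (cst 0) (fun n : nat => 2 * C * n.+1%:R^-1)).
  - near=> n; rewrite normr_ge0/= (le_trans (ler_normB _ _))//.
    have n0 : 0 < n.+1%:R :> R by rewrite ltr0n.
    rewrite ler_pdivlMr// mulrDl mulr_natl mulr2n.
    have := FC n.+1%:R; have := FC (- n.+1%:R).
    by rewrite normrN gtr0_norm// !(mulrC n.+1%:R) => h1 h2; exact: lerD.
  - exact: cvg_cst.
  - rewrite -[X in _ --> X](mulr0 (2 * C)); apply: cvgMr.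
    exact: cvg_harmonic.
by rewrite -(cvg_lim _ cvgI)// (cvg_lim _ cvg0).
Unshelve. all: by end_near. Qed.

Section gaussian_moments.
Variable R : realType.
Notation leb := (@lebesgue_measure R).
Implicit Types (n : nat) (t b x phi : R).

Definition gmom n t x : R := x ^+ n * expR (- (t * x ^+ 2)).

(** The exponential dominates every power of t x ^ 2. *)
Lemma gmom_bounded n t : 0 < t -> exists C, forall x, `|gmom n t x| <= C.
Proof.
move=> t0; exists (1 + (n.+1)`!%:R / t ^+ n.+1) => x.
have tn0 : 0 < t ^+ n.+1 by rewrite exprn_gt0.
have e0 := expR_gt0 (- (t * x ^+ 2)).
have x2 : 0 <= t * x ^+ 2 by rewrite mulr_ge0 ?sqr_ge0 ?ltW.
have xn : `|x| ^+ n <= 1 + (x ^+ 2) ^+ n.+1.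
  have [x1|x1] := leP `|x| 1.
    by rewrite (@le_trans _ _ 1) ?exprn_ile1// lerDl exprn_ge0// sqr_ge0.
  rewrite -(real_normK (num_real x)) -exprM.
  rewrite (@le_trans _ _ (`|x| ^+ (2 * n.+1)))// ?lerDr//.
  by rewrite ler_eXn2l// mulnS mul2n -addnn addnA addnC leq_addr.
rewrite /gmom normrM normrX (gtr0_norm e0).
apply: (le_trans (ler_wpM2r (ltW e0) xn)).
rewrite mulrDl mul1r lerD//; first by rewrite -expR0 ler_expR lerNl oppr0.
have h : (t * x ^+ 2) ^+ n.+1 <= (n.+1)`!%:R * expR (t * x ^+ 2).
  rewrite -ler_pdivrMl ?ltr0n ?fact_gt0// mulrC.
  by rewrite (le_trans _ (expR_ge1Dxn n x2))// lerDr.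
rewrite expRN ler_pdivrMr ?expR_gt0// mulrAC ler_pdivlMr//.
by rewrite -exprMn (mulrC (x ^+ 2)).
Qed.

Lemma gmom_continuous n t : continuous (gmom n t).
Proof.
move=> x; apply: cvgM; first exact: exprn_continuous.
apply: continuous_comp; last exact: continuous_expR.
apply: continuousN; apply: continuousM; first exact: cvg_cst.
exact: exprn_continuous.
Qed.

Lemma measurable_gmom n t : measurable_fun setT (gmom n t).
Proof. exact: continuous_measurable_fun (@gmom_continuous n t). Qed.

Lemma gmom0E t x : 0 < t -> gmom 0 t x =
  Num.sqrt (pi / t) * normal_pdf 0 (Num.sqrt (2 * t))^-1 x.
Proof.
move=> t0; have s0 : (Num.sqrt (2 * t))^-1 != 0.
  by rewrite invr_eq0 sqrtr_eq0 -ltNge mulr_gt0.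
rewrite normal_pdfE// /normal_peak /normal_fun exprVn sqr_sqrtr; last first.
  by rewrite mulr_ge0 ?ltW.
have -> : (2 * t)^-1 * pi *+ 2 = pi / t.
  by rewrite -mulr_natl; field; rewrite gt_eqF.
have -> : (2 * t)^-1 *+ 2 = t^-1.
  by rewrite -mulr_natl; field; rewrite gt_eqF.
rewrite mulrA divff; last first.
  by rewrite sqrtr_eq0 -ltNge divr_gt0 ?pi_gt0.
by rewrite mul1r /gmom expr0 mul1r subr0 invrK mulNr mulrC.
Qed.

(** Half of the Gaussian absorbs the power, the other half is integrable. *)
Lemma integrable_gmom n t : 0 < t -> leb.-integrable setT (EFin \o gmom n t).
Proof.
move=> t0; have t20 : 0 < t / 2 by rewrite divr_gt0.
have [C Cn] := gmom_bounded n t20.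
apply: (@le_integrableR _ _ _ leb (gmom n t) (fun x => C * gmom 0 (t / 2) x)).
- exact: measurable_gmom.
- move=> x; rewrite (_ : gmom n t x = gmom n (t / 2) x * gmom 0 (t / 2) x).
    by rewrite normrM [X in _ * X]ger0_norm ?ler_wpM2r//
      /gmom expr0 mul1r expR_ge0.
  rewrite /gmom expr0 mul1r -mulrA -expRD; congr (_ * expR _).
  by field.
- apply: integrable_scale.
  rewrite (_ : gmom 0 (t / 2) = (fun x => Num.sqrt (pi / (t / 2)) *
    normal_pdf 0 (Num.sqrt (2 * (t / 2)))^-1 x)); last first.
    by apply/funext => x; rewrite gmom0E.
  by apply: integrable_scale; exact: integrable_normal_pdf.
Qed.

Lemma integral_gmom0 t : 0 < t ->
  \int[leb]_x gmom 0 t x = Num.sqrt (pi / t).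
Proof.
move=> t0; under eq_Rintegral do rewrite gmom0E//.
rewrite RintegralZl//; last exact: integrable_normal_pdf.
by rewrite /Rintegral integral_normal_pdf mulr1.
Qed.

Definition cosmom n t b phi : R :=
  \int[leb]_x (gmom n t x * cos (b * x + phi)).

Lemma integrable_cosmom n t b phi : 0 < t ->
  leb.-integrable setT (EFin \o (fun x => gmom n t x * cos (b * x + phi))).
Proof.
move=> t0; apply: integrable_mul_cos; first exact: integrable_gmom.
exact: measurable_funM.
Qed.

Lemma cosDpi2 x : cos (x + pi / 2) = - sin x.
Proof. by rewrite cosD cos_pihalf sin_pihalf mulr0 mulr1 sub0r. Qed.

Lemma gmomS n t x : gmom n.+1 t x = x * gmom n t x.
Proof. by rewrite /gmom exprS mulrA. Qed.

Lemma is_derive_gauss t x :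
  is_derive x 1 (fun x => expR (- (t * x ^+ 2)))
    (- (2 * t * x * expR (- (t * x ^+ 2)))).
Proof.
apply: trigger_derive.
by rewrite /GRing.scale/=; ring.
Qed.

Lemma is_derive_cos_affine b phi x :
  is_derive x 1 (fun x => cos (b * x + phi)) (b * cos (b * x + phi + pi / 2)).
Proof.
apply: trigger_derive.
by rewrite cosDpi2 /GRing.scale/=; ring.
Qed.

End gaussian_moments.

Section gaussian_cosine_transform.
Variable R : realType.
Notation leb := (@lebesgue_measure R).
Implicit Types (n : nat) (t b x phi : R).

(** The derivative of x ^ n exp (- t x ^ 2) cos (b x + phi) has integral 0; the
    derivative of cos is cos shifted by pi / 2, so that the result only involves
    cosine moments. *)
Lemma cosmom_ibp n t b phi : 0 < t ->
  2 * t * cosmom n.+1 t b phi =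
  n%:R * cosmom n.-1 t b phi + b * cosmom n t b (phi + pi / 2).
Proof.
move=> t0; apply/eqP; rewrite eq_sym -subr_eq0; apply/eqP.
have ic k psi := integrable_cosmom k b psi t0.
rewrite /cosmom -!RintegralZl// -RintegralD//; [|exact: integrable_scale..].
rewrite -RintegralB//; [|apply: integrable_add|]; try exact: integrable_scale.
have [C C1] := gmom_bounded n.+1 t0.
apply: (@integral_derivative0 _ (fun x => gmom n t x * cos (b * x + phi)) _ C).
- move=> x; have := is_derive_gauss t x; have := is_derive_cos_affine b phi x.
  move=> dc dg; have := is_deriveX n (is_derive_id x (1 : R)).
  rewrite exprfctE => dx.
  apply: (is_derive_eq (is_deriveM (is_deriveM dx dg) dc)).
  rewrite /GRing.scale/= /gmom addrA !fctE/=.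
  by case: n {C C1 dx} => [|n]; rewrite /= ?expr0 ?exprS; ring.
- move=> x; rewrite /continuous_at.
  have cc (psi : R) : cos (b * y + psi) @[y --> x] --> cos (b * x + psi).
    apply: continuous_comp; last exact: continuous_cos.
    by apply: cvgD; [exact: cvgMr|exact: cvg_cst].
  by apply: cvgB; [apply: cvgD|]; apply: cvgMr; apply: cvgM;
    [exact: gmom_continuous|exact: cc|exact: gmom_continuous|exact: cc|
     exact: gmom_continuous|exact: cc].
- apply: integrable_sub; [apply: integrable_add|]; exact: integrable_scale.
- move=> x; rewrite normrM mulrA -normrM -gmomS (le_trans _ (C1 x))//.
  by rewrite ler_piMr// cos_max.
Qed.

Lemma is_derive_cosmom0 t b phi : 0 < t ->
  is_derive b 1 (fun b => cosmom 0 t b phi) (cosmom 1 t b (phi + pi / 2)).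
Proof.
move=> t0.
pose f c x := gmom 0 t x * cos (c * x + phi).
have df (c x : R) : is_derive c 1 (f^~ x) (gmom 1 t x * cos (c * x + (phi + pi / 2))).
  apply: trigger_derive.
  by rewrite /GRing.scale/= addrA cosDpi2 gmomS; ring.
have Ib : b \in `](b - 1), (b + 1)[ by rewrite in_itv/=; lra.
have h1 c : `](b - 1), (b + 1)[%classic c -> leb.-integrable setT (EFin \o f c).
  by move=> _; exact: integrable_cosmom.
have h2 c x : `](b - 1), (b + 1)[%classic c -> [set: R] x ->
    derivable (f^~ x) c 1.
  by move=> _ _; have [] := df c x.
have h3 x : 0 <= `|gmom 1 t x| by [].
have h4 : leb.-integrable setT (EFin \o (fun x => `|gmom 1 t x|)).
  by apply: integrable_normr; exact: integrable_gmom.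
have h5 c x : `](b - 1), (b + 1)[%classic c -> [set: R] x ->
    `|partial1of2 f c x| <= `|gmom 1 t x|.
  move=> _ _; rewrite /partial1of2 derive1E derive_val normrM.
  by rewrite ler_piMr// cos_max.
have d1 := derivable_under_integral measurableT Ib h1 h2 h3 h4 h5.
have d2 := differentiation_under_integral measurableT Ib h1 h2 h3 h4 h5.
apply: (DeriveDef d1); rewrite -derive1E d2 /cosmom.
apply: eq_Rintegral => x _.
by rewrite /partial1of2 derive1E derive_val.
Qed.

(** Integration by parts turns the derivative of the transform into a linear
    differential equation of first order, whose solutions are Gaussian. *)
Lemma cosmom0E t b phi : 0 < t ->
  cosmom 0 t b phi = cos phi * (Num.sqrt (pi / t) * expR (- (b ^+ 2 / (4 * t)))).
Proof.
move=> t0.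
have ode (c : R) : is_derive c 1 (fun c => cosmom 0 t c phi)
    (- (c / (2 * t)) * cosmom 0 t c phi).
  have := is_derive_cosmom0 c phi t0.
  suff -> : cosmom 1 t c (phi + pi / 2) = - (c / (2 * t)) * cosmom 0 t c phi.
    by [].
  have := cosmom_ibp 0 c (phi + pi / 2) t0; rewrite mul0r add0r.
  have -> : cosmom 0 t c (phi + pi / 2 + pi / 2) = - cosmom 0 t c phi.
    rewrite -mulN1r /cosmom -RintegralZl//; last exact: integrable_cosmom.
    apply: eq_Rintegral => x _; rewrite -addrA -splitr addrA cosDpi; ring.
  move=> e; apply: (@mulfI _ (2 * t)); first by rewrite mulf_neq0// gt_eqF.
  by rewrite e; field; rewrite gt_eqF.
pose H c := cosmom 0 t c phi * expR (c ^+ 2 / (4 * t)).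
have HE : H b = H 0.
  apply: is_derive_0_is_cst => c; rewrite /H.
  have dE : is_derive c 1 (fun c => expR (c ^+ 2 / (4 * t)))
      (c / (2 * t) * expR (c ^+ 2 / (4 * t))).
    apply: trigger_derive; rewrite /GRing.scale/=.
    by field; rewrite gt_eqF.
  have := ode c => dc.
  apply: trigger_derive; rewrite /GRing.scale/=; ring.
have H0 : H 0 = cos phi * Num.sqrt (pi / t).
  rewrite /H expr0n/= mul0r expR0 mulr1 /cosmom.
  under eq_Rintegral do rewrite mul0r add0r.
  by rewrite RintegralZr ?integral_gmom0// 1?mulrC//; exact: integrable_gmom.
rewrite mulrA -H0 -HE /H -mulrA -expRD subrr expR0 mulr1//.
Qed.

(** The cosine transforms at b of the functions exp (- t x ^ 2) and, for kap4,
    x ^ 4 exp (- t x ^ 2); the polynomial in kap4 is the fourth Hermite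
    polynomial. *)
Definition kap0 t b : R := Num.sqrt (pi / t) * expR (- (b ^+ 2 / (4 * t))).

Definition kap4 t b : R := kap0 t b *
  ((3 - 6 * (b ^+ 2 / (2 * t)) + (b ^+ 2 / (2 * t)) ^+ 2) / (4 * t ^+ 2)).

(** Four steps of the recursion given by integration by parts lead from the
    moment of order 4 back to that of order 0. *)
Lemma cosmom4E t b phi : 0 < t -> cosmom 4 t b phi = cos phi * kap4 t b.
Proof.
move=> t0; have tn0 : t != 0 by rewrite gt_eqF.
have t2 : 2 * t != 0 by rewrite mulf_neq0.
have rec n psi := cosmom_ibp n b psi t0.
have c0 psi : cosmom 0 t b (psi + pi / 2 + pi / 2) = - cos psi * kap0 t b.
  by rewrite cosmom0E// -addrA -splitr cosDpi.
have c1 psi : cosmom 1 t b (psi + pi / 2) = - cos psi * kap0 t b * (b / (2 * t)).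
  apply: (mulfI t2); rewrite rec mul0r add0r c0.
  by field.
have c2 psi : cosmom 2 t b psi =
    cos psi * kap0 t b * (1 - b ^+ 2 / (2 * t)) / (2 * t).
  apply: (mulfI t2); rewrite rec c1 /= cosmom0E// -/(kap0 t b).
  by field.
have c2' psi : cosmom 2 t b (psi + pi / 2 + pi / 2) =
    - cos psi * kap0 t b * (1 - b ^+ 2 / (2 * t)) / (2 * t).
  by rewrite c2 -addrA -splitr cosDpi.
have c3 psi : cosmom 3 t b (psi + pi / 2) =
    - cos psi * kap0 t b * b * (3 - b ^+ 2 / (2 * t)) / (2 * t) ^+ 2.
  apply: (mulfI t2); rewrite rec c2' /= c1.
  by field.
apply: (mulfI t2); rewrite rec c3 /= c2 /kap4.
by field.
Qed.

End gaussian_cosine_transform.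

(** * Gaussian kernels in three variables *)

Section space3_measure.
Variable R : realType.
Notation leb := (@lebesgue_measure R).

Definition mu3 : {sigma_finite_measure set (space3 R) -> \bar R} :=
  prodm (prodm leb leb) leb.

Lemma leb3E : leb3 R = mu3. Proof. by []. Qed.

Lemma integrable3 (f1 f2 f3 : R -> R) :
  leb.-integrable setT (EFin \o f1) -> leb.-integrable setT (EFin \o f2) ->
  leb.-integrable setT (EFin \o f3) ->
  mu3.-integrable setT (EFin \o (fun x => f1 x.1.1 * f2 x.1.2 * f3 x.2)).
Proof.
by move=> i1 i2 i3; exact: (integrable_tensor (integrable_tensor i1 i2) i3).
Qed.

Lemma Rintegral3 (f1 f2 f3 : R -> R) :
  leb.-integrable setT (EFin \o f1) -> leb.-integrable setT (EFin \o f2) ->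
  leb.-integrable setT (EFin \o f3) ->
  \int[mu3]_x (f1 x.1.1 * f2 x.1.2 * f3 x.2) =
  (\int[leb]_x f1 x) * (\int[leb]_x f2 x) * (\int[leb]_x f3 x).
Proof.
move=> i1 i2 i3; have i12 := integrable_tensor i1 i2.
rewrite (Fubini1_real (integrable_tensor i12 i3))/=.
under eq_Rintegral do rewrite RintegralZl//.
rewrite RintegralZr// (Fubini1_real i12)/=.
under eq_Rintegral do rewrite RintegralZl//.
by rewrite RintegralZr.
Qed.

Lemma measurable_coord1 : measurable_fun setT (fun x : space3 R => x.1.1).
Proof. exact: measurableT_comp. Qed.

Lemma measurable_coord2 : measurable_fun setT (fun x : space3 R => x.1.2).
Proof. exact: measurableT_comp. Qed.

Lemma measurable_coord3 : measurable_fun setT (fun x : space3 R => x.2).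
Proof. exact: measurable_snd. Qed.

Lemma measurable_fun3 (f1 f2 f3 : R -> R) :
  measurable_fun setT f1 -> measurable_fun setT f2 -> measurable_fun setT f3 ->
  measurable_fun setT (fun x : space3 R => f1 x.1.1 * f2 x.1.2 * f3 x.2).
Proof.
move=> m1 m2 m3; apply: measurable_funM; first apply: measurable_funM.
- exact: (measurableT_comp m1 measurable_coord1).
- exact: (measurableT_comp m2 measurable_coord2).
- exact: (measurableT_comp m3 measurable_coord3).
Qed.

Lemma dot3E (x y : space3 R) :
  dot3 x y = x.1.1 * y.1.1 + x.1.2 * y.1.2 + x.2 * y.2.
Proof. by rewrite /dot3 !big_ord_recr big_ord0/= add0r. Qed.

Lemma norm3E (x : space3 R) :
  norm3 x = Num.sqrt (x.1.1 ^+ 2 + x.1.2 ^+ 2 + x.2 ^+ 2).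
Proof. by rewrite /norm3 !big_ord_recr big_ord0/= add0r. Qed.

End space3_measure.

Section kernels.
Variable R : realType.
Notation leb := (@lebesgue_measure R).
Notation mu3 := (mu3 R).
Implicit Types (e : bool) (t b : R) (x y z xi : space3 R).

Definition gexp e := if e then 4%N else 0%N.

Definition kap e t b : R := if e then kap4 t b else kap0 t b.

Lemma phase_integral_kap e t b : 0 < t ->
  phase_integral leb (gmom (gexp e) t) (fun c : R => b * c) (kap e t b).
Proof.
move=> t0; split; [exact: integrable_gmom|exact: measurable_funM|].
move=> phi; case: e => /=; rewrite -[LHS]/(cosmom _ t b phi).
  by rewrite cosmom4E.
by rewrite cosmom0E.
Qed.

(** The Gaussian exp (- t |xi| ^ 2), multiplied by xi_j ^ 4 for the coordinates
    j whose flag e_j is set. *)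
Definition weight e1 e2 e3 t xi : R :=
  gmom (gexp e1) t xi.1.1 * gmom (gexp e2) t xi.1.2 * gmom (gexp e3) t xi.2.

(** The Fourier transform of [weight] at x - y. *)
Definition kernel e1 e2 e3 t x y : R :=
  kap e1 t (2 * pi * (x.1.1 - y.1.1)) * kap e2 t (2 * pi * (x.1.2 - y.1.2)) *
  kap e3 t (2 * pi * (x.2 - y.2)).

Lemma phase_integral_kernel e1 e2 e3 t x y : 0 < t ->
  phase_integral mu3 (weight e1 e2 e3 t)
    (fun xi => 2 * pi * dot3 x xi - 2 * pi * dot3 y xi)
    (kernel e1 e2 e3 t x y).
Proof.
move=> t0; have p e b := phase_integral_kap e b t0.
have := phase_integral_prod (phase_integral_prod
  (p e1 (2 * pi * (x.1.1 - y.1.1))) (p e2 (2 * pi * (x.1.2 - y.1.2))))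
  (p e3 (2 * pi * (x.2 - y.2))).
rewrite (_ : (fun xi => _ - _) = fun z : space3 R =>
  2 * pi * (x.1.1 - y.1.1) * z.1.1 + 2 * pi * (x.1.2 - y.1.2) * z.1.2 +
  2 * pi * (x.2 - y.2) * z.2)//.
by apply/funext => xi; rewrite !dot3E; ring.
Qed.

Lemma gmom_ge0 e t (x : R) : 0 <= gmom (gexp e) t x.
Proof. by case: e; rewrite mulr_ge0 ?expR_ge0// exprn_even_ge0. Qed.

Lemma weight_ge0 e1 e2 e3 t xi : 0 <= weight e1 e2 e3 t xi.
Proof. by apply: mulr_ge0; [apply: mulr_ge0|]; exact: gmom_ge0. Qed.

Lemma measurable_weight e1 e2 e3 t : measurable_fun setT (weight e1 e2 e3 t).
Proof.
by apply: (@measurable_fun3 R (gmom _ t) (gmom _ t) (gmom _ t));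
  exact: measurable_gmom.
Qed.

Lemma integrable_weight e1 e2 e3 t : 0 < t ->
  mu3.-integrable setT (EFin \o weight e1 e2 e3 t).
Proof.
by move=> t0; exact: (integrable3 (integrable_gmom (gexp e1) t0)
  (integrable_gmom (gexp e2) t0) (integrable_gmom (gexp e3) t0)).
Qed.

Lemma gmom_sqr n t (x : R) : gmom n t x ^+ 2 = gmom (n * 2) (2 * t) x.
Proof.
rewrite /gmom exprMn -exprM -expRM_natl; congr (_ * expR _).
by rewrite -mulr_natl; ring.
Qed.

Lemma integrable_weight_sqr e1 e2 e3 t : 0 < t ->
  mu3.-integrable setT (EFin \o (fun xi => weight e1 e2 e3 t xi ^+ 2)).
Proof.
move=> t0; have t20 : 0 < 2 * t by rewrite mulr_gt0.
have gi n := integrable_gmom n t20.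
have := integrable3 (gi (gexp e1 * 2)%N) (gi (gexp e2 * 2)%N) (gi (gexp e3 * 2)%N).
congr integrable; apply/funext => xi /=.
by rewrite /weight 2!exprMn 3!gmom_sqr.
Qed.

(** The standard deviation for which kap0 becomes a normal density. *)
Definition sdev t : R := Num.sqrt (t / (2 * pi ^+ 2)).

Lemma sdev_neq0 t : 0 < t -> sdev t != 0.
Proof.
by move=> t0; rewrite sqrtr_eq0 -ltNge divr_gt0// mulr_gt0// exprn_gt0// pi_gt0.
Qed.

Lemma kap0_normal t (x y : R) : 0 < t ->
  kap0 t (2 * pi * (x - y)) = normal_pdf y (sdev t) x.
Proof.
move=> t0; have p0 := pi_gt0 R; have pn0 : (pi : R) != 0 by rewrite gt_eqF.
have tn0 : t != 0 by rewrite gt_eqF.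
rewrite normal_pdfE ?sdev_neq0// /normal_peak /normal_fun /sdev sqr_sqrtr.
  rewrite /kap0 (_ : t / _ * pi *+ 2 = (pi / t)^-1); last first.
    by rewrite -mulr_natl; move: (pi : R) pn0 => p pn0; field; rewrite pn0 tn0.
  have pt0 : 0 <= pi / t by rewrite divr_ge0 ?ltW.
  rewrite sqrtrV// invrK; congr (_ * expR _).
  rewrite mulNr; congr (- _).
  by rewrite -mulr_natl; move: (pi : R) pn0 => p pn0; field; rewrite pn0 tn0.
by rewrite divr_ge0 ?mulr_ge0 ?exprn_ge0 ?ltW.
Qed.

Lemma kap0_ge0 t b : 0 <= kap0 t b.
Proof. by rewrite mulr_ge0 ?expR_ge0 ?sqrtr_ge0. Qed.

(** Half of the decay of a Gaussian is split off as a factor; what remains is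
    still a Gaussian of known mass. *)
Lemma kap0_double t b : 0 < t ->
  kap0 t b = Num.sqrt 2 * kap0 (2 * t) b * expR (- (b ^+ 2 / (8 * t))).
Proof.
move=> t0; rewrite /kap0 mulrA -mulrA -expRD -sqrtrM//; congr (_ * expR _).
  by congr Num.sqrt; field; rewrite gt_eqF.
by field; rewrite gt_eqF.
Qed.

Lemma integrable_kap0 t (y : R) : 0 < t ->
  leb.-integrable setT (EFin \o (fun x : R => kap0 t (2 * pi * (x - y)))).
Proof.
move=> t0; under eq_fun do rewrite kap0_normal//.
exact: integrable_normal_pdf.
Qed.

Lemma Rintegral_kap0 t (y : R) : 0 < t ->
  \int[leb]_u kap0 t (2 * pi * (u - y)) = 1.
Proof.
move=> t0; under eq_Rintegral do rewrite kap0_normal//.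
by rewrite /Rintegral integral_normal_pdf.
Qed.

Lemma kap_continuous e t : continuous (kap e t).
Proof.
have c2 : continuous (fun b : R => b ^+ 2) by exact: exprn_continuous.
have c0 : continuous (kap0 t).
  move=> b; apply: cvgMr; apply: continuous_comp; last exact: continuous_expR.
  by apply: cvgN; apply: cvgMl; exact: c2.
case: e => //= b; apply: cvgM; first exact: c0.
apply: cvgMl; apply: cvgD; first apply: cvgB; first exact: cvg_cst.
  by apply: cvgMr; apply: cvgMl; exact: c2.
apply: (@continuous_comp _ _ _ (fun b : R => b ^+ 2 / (2 * t)) (fun b => b ^+ 2)).
  by apply: cvgMl; exact: c2.
exact: c2.
Qed.

Lemma measurable_kap e t : measurable_fun setT (kap e t).
Proof. exact: continuous_measurable_fun (@kap_continuous e t). Qed.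

Lemma measurable_kernel e1 e2 e3 t :
  measurable_fun setT (fun z : space3 R * space3 R => kernel e1 e2 e3 t z.1 z.2).
Proof.
have mk e (f : space3 R -> R) : measurable_fun setT f ->
    measurable_fun setT (fun z : space3 R * space3 R =>
      kap e t (2 * pi * (f z.1 - f z.2))).
  move=> mf; apply: (measurableT_comp (measurable_kap e t)).
  by apply: measurable_funM => //; apply: measurable_funB;
    apply: measurableT_comp.
apply: measurable_funM; first apply: measurable_funM.
- exact: (mk _ _ (@measurable_coord1 R)).
- exact: (mk _ _ (@measurable_coord2 R)).
- exact: (mk _ _ (@measurable_coord3 R)).
Qed.

End kernels.

Section kernel_bounds.
Variable R : realType.
Notation leb := (@lebesgue_measure R).
Notation mu3 := (mu3 R).
Implicit Types (e : bool) (t b c : R) (x y z xi : space3 R).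

Lemma exp_ge_pow n (v : R) : 0 <= v -> (1 + v) ^+ n <= expR (n%:R * v).
Proof.
move=> v0; rewrite expRM_natl lerXn2r ?nnegrE ?expR_ge0 ?addr_ge0//.
exact: expR_ge1Dx.
Qed.

Lemma hermite4_bound (u v : R) : 0 <= u -> u <= v ->
  `|3 - 6 * u + u ^+ 2| <= 3 * (1 + v) ^+ 2.
Proof.
move=> u0 uv; rewrite ler_norml; apply/andP; split; nra.
Qed.

(** One factor exp (- b ^ 2 / (4 t)) of the square absorbs the Hermite
    polynomial; the other one is kept. *)
Lemma kap_sqr_bound e t : 0 < t ->
  exists2 C, 0 <= C & forall b, kap e t b ^+ 2 <= C * kap0 t b.
Proof.
move=> t0; set P : R := Num.sqrt (pi / t).
have P0 : 0 < P by rewrite sqrtr_gt0 divr_gt0 ?pi_gt0.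
have kE b : kap0 t b = P * expR (- (b ^+ 2 / (4 * t))) by [].
have e1 b : expR (- (b ^+ 2 / (4 * t))) <= 1.
  by rewrite -expR0 ler_expR oppr_le0 mulr_ge0 ?sqr_ge0// invr_ge0 mulr_ge0// ltW.
case: e => /=; last first.
  exists P => [|b]; first exact: ltW.
  rewrite expr2 ler_wpM2r ?kap0_ge0// kE.
  by rewrite ler_piMr// ltW.
exists (P * (3 * 256 / (4 * t ^+ 2)) ^+ 2) => [|b].
  by rewrite mulr_ge0 ?sqr_ge0 ?ltW.
rewrite /kap4; set u := b ^+ 2 / (2 * t).
have u0 : 0 <= u by rewrite /u mulr_ge0 ?sqr_ge0// invr_ge0 mulr_ge0// ltW.
have h1 := hermite4_bound u0 (lexx u).
have h2 : (1 + u) ^+ 2 <= 256 * expR (u / 8).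
  have v0 : 0 <= u / 16 by rewrite divr_ge0.
  have := exp_ge_pow 2 v0; rewrite (_ : 2%:R * (u / 16) = u / 8); last by field.
  by nra.
set h := 3 - 6 * u + u ^+ 2.
rewrite (_ : _ ^+ 2 = kap0 t b * (h / (4 * t ^+ 2)) ^+ 2 * kap0 t b); last first.
  by rewrite exprMn expr2 mulrAC.
rewrite ler_wpM2r ?kap0_ge0// kE -(mulrA P).
apply: ler_wpM2l; first exact: ltW.
rewrite !expr_div_n mulrA.
rewrite ler_wpM2r ?invr_ge0 ?sqr_ge0// -(real_normK (num_real h)).
rewrite (_ : b ^+ 2 / (4 * t) = u / 2); last first.
  by rewrite /u; field; rewrite gt_eqF.
rewrite expRN mulrC ler_pdivrMr ?expR_gt0//.
apply: (@le_trans _ _ ((3 * (256 * expR (u / 8))) ^+ 2)).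
  rewrite lerXn2r ?nnegrE// ?mulr_ge0 ?expR_ge0//.
  by rewrite (le_trans h1)// ler_pM2l.
rewrite mulrA exprMn ler_wpM2l ?sqr_ge0// -expRM_natl ler_expR.
lra.
Qed.

Lemma measurable_kap_translate e t (y : R) :
  measurable_fun setT (fun x : R => kap e t (2 * pi * (x - y))).
Proof.
apply: (measurableT_comp (@measurable_kap R e t)).
by apply: measurable_funM => //; exact: measurable_funB.
Qed.

Lemma integrable_kap_sqr e t (y : R) : 0 < t ->
  leb.-integrable setT (EFin \o (fun x : R => kap e t (2 * pi * (x - y)) ^+ 2)).
Proof.
move=> t0; have [C C0 kC] := kap_sqr_bound e t0.
apply: (@le_integrableR _ _ _ leb _
  (fun x : R => C * kap0 t (2 * pi * (x - y)))).
- exact: measurable_funX (measurable_kap_translate _ _ _).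
- by move=> x; rewrite ger0_norm ?sqr_ge0.
- exact/integrable_scale/integrable_kap0.
Qed.

Lemma measurable_kernelr e1 e2 e3 t y :
  measurable_fun setT (fun x => kernel e1 e2 e3 t x y).
Proof.
exact: (@measurable_fun3 R (fun u => kap e1 t (2 * pi * (u - y.1.1)))
  (fun u => kap e2 t (2 * pi * (u - y.1.2)))
  (fun u => kap e3 t (2 * pi * (u - y.2)))
  (measurable_kap_translate _ _ _) (measurable_kap_translate _ _ _)
  (measurable_kap_translate _ _ _)).
Qed.

Lemma integrable_kernel_sqr e1 e2 e3 t y : 0 < t ->
  mu3.-integrable setT (EFin \o (fun x => kernel e1 e2 e3 t x y ^+ 2)).
Proof.
move=> t0; have ki e (u : R) := integrable_kap_sqr e u t0.
have := integrable3 (ki e1 y.1.1) (ki e2 y.1.2) (ki e3 y.2).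
congr integrable; apply/funext => x /=.
by rewrite /kernel 2!exprMn.
Qed.

(** The heat kernel, up to a change of the time parameter. *)
Definition heat t x y : R := kernel false false false t x y.

Lemma heat_ge0 t x y : 0 <= heat t x y.
Proof. by rewrite /heat/kernel/= !mulr_ge0 ?kap0_ge0. Qed.

Lemma heatC t x y : heat t x y = heat t y x.
Proof.
by rewrite /heat /kernel /= /kap0 -(opprB y.1.1) -(opprB y.1.2) -(opprB y.2);
  rewrite !mulrN !sqrrN.
Qed.

Lemma integrable_heat t y : 0 < t ->
  mu3.-integrable setT (EFin \o (fun x => heat t x y)).
Proof.
by move=> t0; exact: (integrable3 (integrable_kap0 y.1.1 t0)
  (integrable_kap0 y.1.2 t0) (integrable_kap0 y.2 t0)).
Qed.

Lemma Rintegral_heat t y : 0 < t -> \int[mu3]_x heat t x y = 1.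
Proof.
move=> t0; have := Rintegral3 (integrable_kap0 y.1.1 t0)
  (integrable_kap0 y.1.2 t0) (integrable_kap0 y.2 t0).
by rewrite !Rintegral_kap0// !mulr1.
Qed.

(** With U = (b1 ^ 2 + b2 ^ 2 + b3 ^ 2) / (2 t), the product is
    t ^ (- 7 / 2) exp (- U / 2) times a quadratic polynomial in a part of U,
    hence at most a multiple of t ^ (- 7 / 2) (1 + U) ^ (- 3). As
    1 + U >= (t + c) / t, the right-hand side is integrable in t down to t = 0,
    which is what makes the superposition of these kernels finite away from the
    diagonal. *)
Lemma kap400_bound t b1 b2 b3 c : 0 < t -> 0 < c ->
  2 * c <= b1 ^+ 2 + b2 ^+ 2 + b3 ^+ 2 ->
  t * `|kap4 t b1 * kap0 t b2 * kap0 t b3| <=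
  3 * 10 ^+ 5 * pi * Num.sqrt (pi / c) / (t + c) ^+ 2.
Proof.
move=> t0 c0 cb; have tn0 : t != 0 by rewrite gt_eqF.
have p0 := pi_gt0 R.
have tcn0 : t + c != 0 by rewrite gt_eqF// addr_gt0.
have aux1 (x p k : R) : x * (p / t) * (t / (4 * t ^+ 2)) *
    (k * (t / (t + c)) ^+ 3) = x * t * (k * p / (4 * (t + c) ^+ 3)).
  by field; rewrite tn0 tcn0.
have aux2 (x p k : R) : x * (t + c) * (k * p / (4 * (t + c) ^+ 3)) =
    k * p * x / (t + c) ^+ 2 / 4.
  by field; rewrite tcn0.
set P : R := Num.sqrt (pi / t).
have P0 : 0 < P by rewrite sqrtr_gt0 divr_gt0.
have P2 : P ^+ 2 = pi / t by rewrite sqr_sqrtr// divr_ge0 ?ltW.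
have tc0 : 0 < t + c by rewrite addr_gt0.
pose U := (b1 ^+ 2 + b2 ^+ 2 + b3 ^+ 2) / (2 * t).
set u := b1 ^+ 2 / (2 * t).
have u0 : 0 <= u by rewrite /u mulr_ge0 ?sqr_ge0// invr_ge0 mulr_ge0// ltW.
have uU : u <= U.
  have t20 : 0 <= (2 * t)^-1 by rewrite invr_ge0 mulr_ge0// ltW.
  by rewrite /u /U ler_wpM2r// -addrA lerDl addr_ge0 ?sqr_ge0.
have U0 : 0 <= U by rewrite (le_trans u0).
have Uc : (t + c) / t <= 1 + U.
  rewrite mulrDl divff// lerD2l /U ler_pdivlMr ?mulr_gt0//.
  by rewrite (_ : c / t * (2 * t) = 2 * c)//; field.
have h1 := hermite4_bound u0 uU.
have h2 : (1 + U) ^+ 5 <= 10 ^+ 5 * expR (U / 2).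
  have v0 : 0 <= U / 10 by rewrite divr_ge0.
  have := exp_ge_pow 5 v0; rewrite (_ : 5%:R * (U / 10) = U / 2); last by field.
  move=> h; apply: (@le_trans _ _ (10 ^+ 5 * (1 + U / 10) ^+ 5)).
    rewrite -exprMn lerXn2r ?nnegrE ?addr_ge0//; last lra.
    by rewrite mulr_ge0// addr_ge0.
  by rewrite ler_pM2l.
have kE : kap4 t b1 * kap0 t b2 * kap0 t b3 =
    P * (pi / t) * expR (- (U / 2)) * (3 - 6 * u + u ^+ 2) / (4 * t ^+ 2).
  rewrite /kap4 /kap0 -/P -/u -P2.
  rewrite (_ : - (U / 2) = - (b1 ^+ 2 / (4 * t)) + - (b2 ^+ 2 / (4 * t)) +
    - (b3 ^+ 2 / (4 * t))); last by rewrite /U; field.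
  by rewrite !expRD; ring.
rewrite kE normrM (ger0_norm (_ : 0 <= (4 * t ^+ 2)^-1)); last first.
  by rewrite invr_ge0 mulr_ge0 ?sqr_ge0.
rewrite normrM ger0_norm; last first.
  by rewrite !mulr_ge0 ?expR_ge0 ?invr_ge0 ?(ltW P0) ?(ltW p0) ?(ltW t0).
(* (1 + U) ^+ 5 splits into the two powers that bound the Hermite factor and
   the three powers that give the decay in t + c *)
have h3 : expR (- (U / 2)) * `|3 - 6 * u + u ^+ 2| <=
    3 * 10 ^+ 5 * (t / (t + c)) ^+ 3.
  rewrite expRN ler_pdivrMl ?expR_gt0// (le_trans h1)//.
  have w0 : 0 < (t + c) / t by rewrite divr_gt0.
  rewrite -[t / (t + c)]invf_div exprVn [leRHS]mulrA ler_pdivlMr ?exprn_gt0//.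
  have h4 : ((t + c) / t) ^+ 3 <= (1 + U) ^+ 3.
    by rewrite lerXn2r ?nnegrE ?addr_ge0// ltW.
  apply: (@le_trans _ _ (3 * (1 + U) ^+ 2 * (1 + U) ^+ 3)).
    by rewrite ler_wpM2l// mulr_ge0 ?exprn_ge0 ?addr_ge0.
  rewrite -mulrA -exprD mulrC -[leRHS]mulrC -[leRHS]mulrA [leLHS]mulrC.
  by apply: ler_wpM2l h2.
(* P * t is sqrt (pi t), and t c <= (t + c) ^+ 2 *)
have h5 : P * t <= Num.sqrt (pi / c) * (t + c).
  rewrite -[X in P * X](ger0_norm (ltW t0)) -[t + c](ger0_norm (ltW tc0)).
  rewrite -!sqrtr_sqr -!sqrtrM ?divr_ge0 ?(ltW p0) ?(ltW t0) ?(ltW c0)//.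
  apply: ler_wsqrtr; rewrite (_ : pi / t * t ^+ 2 = pi * t); last by field.
  rewrite [leRHS]mulrAC ler_pdivlMr// -mulrA ler_pM2l//.
  by have := sqr_ge0 t; have := sqr_ge0 c; have := mulr_gt0 t0 c0; nra.
set K : R := 3 * 10 ^+ 5.
have K0 : 0 <= K by rewrite mulr_ge0// exprn_ge0.
set E := expR _ in h3 *; set h : R := `|_| in h3 *.
apply: (@le_trans _ _ (P * (pi / t) * (t / (4 * t ^+ 2)) *
    (K * (t / (t + c)) ^+ 3))).
  rewrite (_ : t * _ = P * (pi / t) * (t / (4 * t ^+ 2)) * (E * h)); last by ring.
  apply: ler_wpM2l h3.
  by rewrite !mulr_ge0 ?invr_ge0 ?mulr_ge0 ?sqr_ge0 ?(ltW P0) ?(ltW p0) ?(ltW t0).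
rewrite (_ : _ * (K * _) = P * t * (K * pi / (4 * (t + c) ^+ 3))); last first.
  exact: aux1.
apply: (@le_trans _ _ (Num.sqrt (pi / c) * (t + c) *
    (K * pi / (4 * (t + c) ^+ 3)))).
  apply: ler_wpM2r h5.
  rewrite mulr_ge0 ?invr_ge0 ?mulr_ge0 ?exprn_ge0 ?(ltW p0) ?(ltW tc0)//.
rewrite aux2.
rewrite ler_pdivrMr// ler_peMr//; last by rewrite ler1n.
by rewrite !mulr_ge0 ?invr_ge0 ?exprn_ge0 ?sqrtr_ge0 ?(ltW p0) ?(ltW tc0).
Qed.

End kernel_bounds.

(** * Complex-valued functions and the multiplication formula *)

Lemma ge0_integrable d (T : measurableType d) (R : realType)
    (mu : {measure set T -> \bar R}) (f : T -> R) :
  measurable_fun setT f -> (forall x, 0 <= f x) ->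
  (\int[mu]_x (f x)%:E < +oo)%E -> mu.-integrable setT (EFin \o f).
Proof.
move=> mf f0 foo; apply/integrableP; split; first exact/measurable_EFinP.
by under eq_integral => x _ do rewrite /= (ger0_norm (f0 x)).
Qed.

Section complex_functions.
Variable R : realType.
Notation mu3 := (mu3 R).
Implicit Types (f g u v : space3 R -> R[i]) (z : R[i]).

(** The real part of z multiplied by the unit complex number of argument
    tau. *)
Definition rot (tau : R) z : R :=
  complex.Re z * cos tau - complex.Im z * sin tau.

Lemma cmodE z : cmod z = Num.sqrt (complex.Re z ^+ 2 + complex.Im z ^+ 2).
Proof. by case: z. Qed.

Lemma cmod_sqr z : cmod z ^+ 2 = complex.Re z ^+ 2 + complex.Im z ^+ 2.
Proof. by rewrite cmodE sqr_sqrtr// addr_ge0 ?sqr_ge0. Qed.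

Lemma cmod_ge0 z : 0 <= cmod z.
Proof. by rewrite cmodE sqrtr_ge0. Qed.

Lemma norm_rot_le tau z : `|rot tau z| <= cmod z.
Proof.
rewrite -(@ler_pXn2r _ 2) ?nnegrE ?cmod_ge0// cmod_sqr real_normK ?num_real//.
have := cos2Dsin2 tau; rewrite /rot.
have := sqr_ge0 (complex.Re z * sin tau + complex.Im z * cos tau).
move=> h1 h2; rewrite -subr_ge0.
rewrite (_ : _ - _ = (complex.Re z * sin tau + complex.Im z * cos tau) ^+ 2 +
  (complex.Re z ^+ 2 + complex.Im z ^+ 2) * (1 - (cos tau ^+ 2 + sin tau ^+ 2))).
  by rewrite h2 subrr mulr0 addr0.
ring.
Qed.

Lemma norm_Re_le z : `|complex.Re z| <= cmod z.
Proof.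
by have := norm_rot_le 0 z; rewrite /rot cos0 sin0 mulr1 mulr0 subr0.
Qed.

Lemma norm_Im_le z : `|complex.Im z| <= cmod z.
Proof.
have := norm_rot_le (- (pi / 2)) z.
by rewrite /rot cosN sinN cos_pihalf sin_pihalf mulr0 mulrN1 sub0r opprK.
Qed.

Lemma cmod_le_ReIm z : cmod z <= `|complex.Re z| + `|complex.Im z|.
Proof.
rewrite -(@ler_pXn2r _ 2) ?nnegrE ?cmod_ge0 ?addr_ge0// cmod_sqr sqrrD.
rewrite !real_normK ?num_real// addrAC lerDl.
by rewrite mulrn_wge0// mulr_ge0.
Qed.

Lemma rotB tau z1 z2 : rot tau (z1 - z2) = rot tau z1 - rot tau z2.
Proof. by case: z1 z2 => [a b] [c e]; rewrite /rot/=; ring. Qed.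

Definition cmeasurable f : Prop :=
  measurable_fun setT (fun x => complex.Re (f x)) /\
  measurable_fun setT (fun x => complex.Im (f x)).

Lemma cmeasurableB f g : cmeasurable f -> cmeasurable g ->
  cmeasurable (fun x => f x - g x).
Proof.
move=> [f1 f2] [g1 g2]; split.
- rewrite (_ : (fun x => _) = fun x => complex.Re (f x) - complex.Re (g x)).
    exact: measurable_funB.
  by apply/funext => x; case: (f x) (g x) => ? ? [].
- rewrite (_ : (fun x => _) = fun x => complex.Im (f x) - complex.Im (g x)).
    exact: measurable_funB.
  by apply/funext => x; case: (f x) (g x) => ? ? [].
Qed.

Lemma measurable_sin : measurable_fun setT (@sin R).
Proof. by apply: continuous_measurable_fun => x; exact: continuous_sin. Qed.

Lemma measurable_rot f (tau : space3 R -> R) :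
  cmeasurable f -> measurable_fun setT tau ->
  measurable_fun setT (fun x => rot (tau x) (f x)).
Proof.
move=> [f1 f2] mt; apply: measurable_funB; apply: measurable_funM => //.
- exact: (measurableT_comp (@measurable_cos R) mt).
- exact: (measurableT_comp measurable_sin mt).
Qed.

Lemma measurable_cmod f : cmeasurable f ->
  measurable_fun setT (fun x => cmod (f x)).
Proof.
move=> [f1 f2].
rewrite (_ : (fun x => _) = (@Num.sqrt R) \o
    (fun x => complex.Re (f x) ^+ 2 + complex.Im (f x) ^+ 2)); last first.
  by apply/funext => x; rewrite cmodE.
apply: measurableT_comp.
  by apply: continuous_measurable_fun => x; exact: sqrt_continuous.
by apply: measurable_funD; exact: measurable_funX.
Qed.

Lemma normL1E f : normLp 1 f = (\int[mu3]_x (cmod (f x))%:E)%E.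
Proof.
rewrite /normLp Lnorm1; apply: eq_integral => x _ /=.
by rewrite ger0_norm// cmod_ge0.
Qed.

Lemma inL1_integrable f : inLp 1 f ->
  mu3.-integrable setT (EFin \o (fun x => cmod (f x))).
Proof.
move=> [f1 f2]; rewrite normL1E; apply: ge0_integrable => [|x].
  by apply: measurable_cmod; split.
exact: cmod_ge0.
Qed.

Lemma normL1_fin f : inLp 1 f ->
  normLp 1 f = (\int[mu3]_x cmod (f x))%R%:E.
Proof. by move=> /inL1_integrable fi; rewrite normL1E EFin_Rintegral. Qed.

Lemma normL2E f : normLp 2 f = ((\int[mu3]_x (cmod (f x) ^+ 2)%:E) `^ 2^-1)%E.
Proof.
rewrite /normLp unlock; congr (_ `^ _)%E; apply: eq_integral => x _ /=.
by rewrite powR_mulrn// real_normK// num_real.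
Qed.

Lemma normL2_integrable f : cmeasurable f -> (normLp 2 f < +oo)%E ->
  mu3.-integrable setT (EFin \o (fun x => cmod (f x) ^+ 2)) /\
  fine (normLp 2 f) = Num.sqrt (\int[mu3]_x (cmod (f x) ^+ 2)).
Proof.
move=> mf foo; have foo2 := poweR_lty 2 foo.
have fi : mu3.-integrable setT (EFin \o (fun x => cmod (f x) ^+ 2)).
  apply: ge0_integrable => [|x|]; last 2 first.
  - exact: sqr_ge0.
  - move: foo2; rewrite normL2E -poweRrM mulVf// poweRe1//.
    by apply: integral_ge0 => x _; rewrite lee_fin sqr_ge0.
  by apply: measurable_funX; exact: (measurable_cmod mf).
split => //; rewrite normL2E -EFin_Rintegral//= powR12_sqrt//.
by apply: Rintegral_ge0 => x _; exact: sqr_ge0.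
Qed.

Lemma inL2_integrable f : inLp 2 f ->
  mu3.-integrable setT (EFin \o (fun x => cmod (f x) ^+ 2)).
Proof. by move=> [f1 f2 f3]; have [] := normL2_integrable (conj f1 f2) f3. Qed.

Lemma integrable_rot_sqr f (tau : space3 R -> R) : cmeasurable f ->
  measurable_fun setT tau ->
  mu3.-integrable setT (EFin \o (fun x => cmod (f x) ^+ 2)) ->
  mu3.-integrable setT (EFin \o (fun x => rot (tau x) (f x) ^+ 2)).
Proof.
move=> mf mt; apply: le_integrableR.
  by apply: measurable_funX; exact: (measurable_rot mf mt).
move=> x; rewrite normrX lerXn2r ?nnegrE ?cmod_ge0//; exact: norm_rot_le.
Qed.

Lemma integrable_rot_mul f (tau w : space3 R -> R) : cmeasurable f ->
  measurable_fun setT tau -> measurable_fun setT w ->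
  mu3.-integrable setT (EFin \o (fun x => cmod (f x) ^+ 2)) ->
  mu3.-integrable setT (EFin \o (fun x => w x ^+ 2)) ->
  mu3.-integrable setT (EFin \o (fun x => rot (tau x) (f x) * w x)).
Proof.
move=> mf mt mw fi wi; apply: integrable_mul_sqr => //.
- exact: measurable_rot.
- exact: integrable_rot_sqr.
Qed.

Lemma rot_mul_bound f (tau w : space3 R -> R) : cmeasurable f ->
  measurable_fun setT tau -> measurable_fun setT w ->
  (normLp 2 f < +oo)%E ->
  mu3.-integrable setT (EFin \o (fun x => w x ^+ 2)) ->
  `|\int[mu3]_x (rot (tau x) (f x) * w x)| <=
  fine (normLp 2 f) * Num.sqrt (\int[mu3]_x (w x ^+ 2)).
Proof.
move=> mf mt mw foo wi; have [fi ->] := normL2_integrable mf foo.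
have fi2 := integrable_rot_sqr mf mt fi.
rewrite -sqrtrM; last by apply: Rintegral_ge0 => x _; exact: sqr_ge0.
rewrite -sqrtr_sqr ler_wsqrtr//.
apply: (le_trans (Rintegral_cauchy_schwarz _ _ _ _)) => //.
  exact: measurable_rot.
apply: ler_wpM2r; first by apply: Rintegral_ge0 => x _; exact: sqr_ge0.
apply: le_Rintegral => // x _.
rewrite -(real_normK (num_real (rot _ _))) lerXn2r ?nnegrE ?cmod_ge0//.
exact: norm_rot_le.
Qed.

(** Weak convergence: pairing with a fixed square-integrable weight is
    continuous for the L2 distance. *)
Lemma rot_mul_cvg f (u : nat -> space3 R -> R[i]) (tau w : space3 R -> R) :
  cmeasurable f -> (forall n, cmeasurable (u n)) ->
  measurable_fun setT tau -> measurable_fun setT w ->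
  (normLp 2 f < +oo)%E ->
  mu3.-integrable setT (EFin \o (fun x => w x ^+ 2)) ->
  (fun n => normLp 2 (fun x => u n x - f x)) @ \oo --> 0%E ->
  \int[mu3]_x (rot (tau x) (u n x) * w x) @[n --> \oo] -->
  \int[mu3]_x (rot (tau x) (f x) * w x).
Proof.
move=> mf mu mt mw foo wi /fine_cvgP[Nfin Ncvg].
have [fi _] := normL2_integrable mf foo.
apply/subr_cvg0; apply: norm_cvg0.
set c := Num.sqrt (\int[mu3]_x (w x ^+ 2)).
have Nc : fine (normLp 2 (fun x => u n x - f x)) * c @[n --> \oo] --> (0 : R).
  by rewrite -[X in _ --> X](mul0r c); apply: cvgMl; exact: Ncvg.
apply: (@squeeze_cvgr _ _ _ _ (cst 0) _ _ _ _ _ Nc).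
- near=> n; rewrite normr_ge0/=.
  have Nn : (normLp 2 (fun x => (u n x - f x)%R) < +oo)%E.
    by rewrite ltey_eq; apply/orP; left; near: n.
  have mv := cmeasurableB (mu n) mf.
  have [vi _] := normL2_integrable mv Nn.
  have iv := integrable_rot_mul mv mt mw vi wi.
  have i_f := integrable_rot_mul mf mt mw fi wi.
  have iu : mu3.-integrable setT
      (EFin \o (fun x => rot (tau x) (u n x) * w x)).
    have := integrable_add iv i_f; congr integrable.
    by apply/funext => x /=; rewrite rotB -mulrDl subrK.
  rewrite -RintegralB//.
  under eq_Rintegral do rewrite -mulrBl -rotB.
  exact: rot_mul_bound.
- exact: cvg_cst.
Unshelve. all: by end_near. Qed.

End complex_functions.

Section multiplication_formula.
Variable R : realType.
Notation mu3 := (mu3 R).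
Implicit Types (f g u v : space3 R -> R[i]) (x y xi : space3 R).

Lemma Re_character3M xi x (z : R[i]) :
  complex.Re (character3 xi x * z) =
  rot (- (2 * pi * dot3 x xi)) z.
Proof.
by case: z => p q; rewrite /rot/character3/= cosN sinN; ring.
Qed.

Lemma Im_character3M xi x (z : R[i]) :
  complex.Im (character3 xi x * z) =
  rot (- (2 * pi * dot3 x xi) - pi / 2) z.
Proof.
case: z => p q; rewrite /rot/character3/= -opprD cosN sinN.
by rewrite cosDpi2 sinD cos_pihalf sin_pihalf; ring.
Qed.

Lemma rotD tau1 tau2 (z : R[i]) :
  rot (tau1 + tau2) z = cos tau1 * rot tau2 z + sin tau1 * rot (tau2 + pi / 2) z.
Proof.
rewrite /rot !cosD !sinD cos_pihalf sin_pihalf; ring.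
Qed.

Lemma measurable_dot3 : measurable_fun setT
  (fun z : space3 R * space3 R => dot3 z.1 z.2).
Proof.
have m1 := @measurable_coord1 R; have m2 := @measurable_coord2 R.
have m3 := @measurable_coord3 R.
rewrite (_ : (fun z => _) = fun z : space3 R * space3 R =>
  z.1.1.1 * z.2.1.1 + z.1.1.2 * z.2.1.2 + z.1.2 * z.2.2); last first.
  by apply/funext => z; rewrite dot3E.
have mf := @measurable_fst _ _ (space3 R) (space3 R).
have ms := @measurable_snd _ _ (space3 R) (space3 R).
apply: measurable_funD; first apply: measurable_funD; apply: measurable_funM.
- exact: (measurableT_comp m1 mf).
- exact: (measurableT_comp m1 ms).
- exact: (measurableT_comp m2 mf).
- exact: (measurableT_comp m2 ms).
- exact: (measurableT_comp m3 mf).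
- exact: (measurableT_comp m3 ms).
Qed.

Lemma measurable_dot3r y : measurable_fun setT (fun xi => dot3 y xi).
Proof.
rewrite (_ : (fun z => _) = fun z : space3 R =>
  y.1.1 * z.1.1 + y.1.2 * z.1.2 + y.2 * z.2); last first.
  by apply/funext => z; rewrite dot3E.
by apply: measurable_funD; first apply: measurable_funD;
  apply: measurable_funM => //; apply: measurableT_comp.
Qed.

Lemma measurable_rot_pair u (tau : space3 R * space3 R -> R) :
  cmeasurable u -> measurable_fun setT tau ->
  measurable_fun setT (fun z : space3 R * space3 R => rot (tau z) (u z.2)).
Proof.
move=> [u1 u2] mt; have ms := @measurable_snd _ _ (space3 R) (space3 R).
apply: measurable_funB; apply: measurable_funM.
- exact: (measurableT_comp u1 ms).
- exact: (measurableT_comp (@measurable_cos R) mt).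
- exact: (measurableT_comp u2 ms).
- exact: (measurableT_comp (@measurable_sin R) mt).
Qed.

Lemma measurable_dot3C : measurable_fun setT
  (fun z : space3 R * space3 R => 2 * pi * dot3 z.2 z.1).
Proof.
apply: measurable_funM => //.
have mp : measurable_fun setT
    (fun z : space3 R * space3 R => (z.2, z.1)).
  by apply: measurable_fun_pair.
exact: (measurableT_comp measurable_dot3 mp).
Qed.

Lemma measurable_fourierL1 u : cmeasurable u -> cmeasurable (fourierL1 u).
Proof.
move=> mu; split => /=.
- apply: (@measurable_fun_Rintegral _ _ _ _ _ mu3
    (fun z => complex.Re (character3 z.1 z.2 * u z.2))).
  under eq_fun do rewrite Re_character3M.
  by apply: measurable_rot_pair => //; apply: measurableT_comp => //;
    exact: measurable_dot3C.
- apply: (@measurable_fun_Rintegral _ _ _ _ _ mu3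
    (fun z => complex.Im (character3 z.1 z.2 * u z.2))).
  under eq_fun do rewrite Im_character3M.
  apply: measurable_rot_pair => //; apply: measurable_funB => //.
  by apply: measurableT_comp => //; exact: measurable_dot3C.
Qed.

Lemma integrable_rot u (tau : space3 R -> R) : inLp 1 u ->
  measurable_fun setT tau ->
  mu3.-integrable setT (EFin \o (fun x => rot (tau x) (u x))).
Proof.
move=> iu mt; have [u1 u2 _] := iu.
apply: (le_integrableR _ _ (inL1_integrable iu)).
  exact: (measurable_rot (conj u1 u2) mt).
by move=> x; exact: norm_rot_le.
Qed.

Lemma measurable_dot3l xi : measurable_fun setT (fun x => 2 * pi * dot3 x xi).
Proof.
apply: measurable_funM => //.
rewrite (_ : (fun x => _) = (fun x => dot3 xi x)); first exact: measurable_dot3r.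
by apply/funext => x; rewrite !dot3E; ring.
Qed.

Lemma rot_fourierL1 tau u xi : inLp 1 u ->
  rot tau (fourierL1 u xi) = \int[mu3]_x rot (tau - 2 * pi * dot3 x xi) (u x).
Proof.
move=> iu; have md := measurable_dot3l xi.
rewrite {1}/rot /fourierL1 /cint3/= leb3E.
under eq_Rintegral do rewrite Re_character3M.
under [X in _ - X * _]eq_Rintegral do rewrite Im_character3M.
rewrite -RintegralZr//; last by apply: integrable_rot => //; exact: measurableT_comp.
rewrite -RintegralZr//; last first.
  apply: integrable_rot => //; apply: measurable_funB => //.
  exact: measurableT_comp.
rewrite -RintegralB//; last 2 first.
- under eq_fun do rewrite mulrC.
  by apply/integrable_scale/integrable_rot => //; exact: measurableT_comp.
- under eq_fun do rewrite mulrC.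
  apply/integrable_scale/integrable_rot => //; apply: measurable_funB => //.
  exact: measurableT_comp.
apply: eq_Rintegral => x _.
rewrite rotD /rot !(cosB, sinB, cosD, sinD, cosN, sinN, cos_pihalf, sin_pihalf).
ring.
Qed.

(** The weight against which a transform is tested is real and even, so its
    own transform is real: the phase phi passes through the integral. *)
Lemma multiplication_formula e1 e2 e3 t y phi u : 0 < t -> inLp 1 u ->
  \int[mu3]_xi (rot (2 * pi * dot3 y xi - phi) (fourierL1 u xi) *
                weight e1 e2 e3 t xi) =
  \int[mu3]_x (rot (- phi) (u x) * kernel e1 e2 e3 t x y).
Proof.
move=> t0 iu; have [u1 u2 _] := iu.
set w := weight e1 e2 e3 t.
have wi : mu3.-integrable setT (EFin \o w) by exact: integrable_weight.
have mw : measurable_fun setT w by exact: measurable_weight.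
pose tau (z : space3 R * space3 R) :=
  2 * pi * dot3 y z.1 - phi - 2 * pi * dot3 z.2 z.1.
pose G z := rot (tau z) (u z.2) * w z.1.
have mf := @measurable_fst _ _ (space3 R) (space3 R).
have mtau : measurable_fun setT tau.
  apply: measurable_funB; last exact: measurable_dot3C.
  apply: measurable_funB => //; apply: measurable_funM => //.
  exact: (measurableT_comp (measurable_dot3r y) mf).
have mG : measurable_fun setT G.
  apply: measurable_funM; last exact: (measurableT_comp mw mf).
  exact: (measurable_rot_pair (conj u1 u2)).
have iG : (prodm mu3 mu3).-integrable setT (EFin \o G).
  apply: (le_integrableR mG _ (integrable_tensor wi (inL1_integrable iu))).
  move=> z; rewrite /G normrM mulrC ger0_norm ?weight_ge0//=.
  by apply: ler_wpM2l; [exact: weight_ge0|exact: norm_rot_le].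
transitivity (\int[mu3]_xi \int[mu3]_x G (xi, x)).
  apply: eq_Rintegral => xi _; rewrite rot_fourierL1// -RintegralZr//.
  apply: integrable_rot => //; apply: measurable_funB => //.
  exact: measurable_dot3l.
rewrite Fubini_real//; apply: eq_Rintegral => x _.
have [_ mth ph] := phase_integral_kernel e1 e2 e3 x y t0.
set th := (fun xi => _) in mth ph.
under eq_Rintegral => xi _.
  have -> : G (xi, x) = complex.Re (u x) * (w xi * cos (th xi + phi)) +
      complex.Im (u x) * (w xi * cos (th xi + (phi - pi / 2))).
    rewrite /G/rot/tau/= -(cosN (_ - _)) -(opprK (sin _)) -sinN.
    rewrite (_ : - (_ - _) = th xi + phi); last by rewrite /th; ring.
    rewrite [th xi + (phi - _)]addrA cosB sin_pihalf cos_pihalf.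
    ring.
  over.
rewrite RintegralD//; try exact/integrable_scale/integrable_mul_cos.
rewrite !RintegralZl//; try exact: integrable_mul_cos.
rewrite !ph /rot cosB cosN sinN cos_pihalf sin_pihalf; ring.
Qed.

(** Both sides of the multiplication formula are continuous for the L2
    distance, the weight and its kernel being square-integrable. This is the
    only property of the Fourier-Plancherel transform that is used. *)
Lemma fourierL2_multiplication e1 e2 e3 t y phi f F : 0 < t ->
  is_fourierL2 f F ->
  \int[mu3]_xi (rot (2 * pi * dot3 y xi - phi) (F xi) * weight e1 e2 e3 t xi) =
  \int[mu3]_x (rot (- phi) (f x) * kernel e1 e2 e3 t x y).
Proof.
move=> t0 [[f1 f2 foo] [F1 F2 Foo] [u [u12 uf uF]]].
have mu n : cmeasurable (u n) by have [[]] := u12 n.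
have mU n : cmeasurable (fourierL1 (u n)) by exact: measurable_fourierL1.
have mt : measurable_fun setT (fun xi => 2 * pi * dot3 y xi - phi).
  apply: measurable_funB => //; apply: measurable_funM => //.
  exact: measurable_dot3r.
have := rot_mul_cvg (conj F1 F2) mU mt (measurable_weight e1 e2 e3 t) Foo
  (integrable_weight_sqr e1 e2 e3 t0) uF.
under eq_fun do rewrite (multiplication_formula e1 e2 e3 y phi t0 (u12 _).1).
have := @rot_mul_cvg _ _ _ (fun _ => - phi) _ (conj f1 f2) mu _
  (measurable_kernelr e1 e2 e3 t y) foo (integrable_kernel_sqr e1 e2 e3 y t0) uf.
move=> /(_ (measurable_cst _)) c1 c2.
by rewrite -(cvg_lim _ c1)// -(cvg_lim _ c2).
Qed.

End multiplication_formula.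

(** * The multiplier as a superposition of Gaussians *)

Section half_line.
Variable R : realType.
Notation leb := (@lebesgue_measure R).

(** Extension by 0 keeps integrals over the half-line in the setting of
    integrals over the whole line. *)
Definition halfline (f : R -> R) (s : R) : R := if 0 <= s then f s else 0.

Lemma measurable_halfline (f : R -> R) : measurable_fun (`[0, +oo[%classic : set R) f ->
  measurable_fun setT (halfline f).
Proof.
move=> mf; rewrite (_ : halfline f = f \_ `[0, +oo[).
  by apply/(measurable_restrictT _ _).1.
by apply/funext => s; rewrite patchE /halfline mem_setE in_itv/= andbT.
Qed.

Lemma halfline_FTC (f F : R -> R) (l : R) :
  (forall s, 0 <= s -> 0 <= f s) ->
  (forall s : R, 0 <= s -> is_derive s 1 F (f s)) ->
  (forall s : R, 0 <= s -> {for s, continuous f}) ->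
  F s @[s --> +oo] --> l ->
  leb.-integrable setT (EFin \o halfline f) /\
  \int[leb]_s halfline f s = l - F 0.
Proof.
move=> f0 dF cf Fl.
have cfw : {within `[0, +oo[, continuous f}.
  apply: continuous_in_subspaceT => s; rewrite mem_setE in_itv/= andbT.
  exact: cf.
have mf : measurable_fun (`[0, +oo[%classic : set R) f.
  exact: subspace_continuous_measurable_fun.
have I : (\int[leb]_(s in `[(0 : R)%R, +oo[) (f s)%:E = l%:E - (F 0)%:E)%E.
  apply: ge0_continuous_FTC2y => //.
  - by move=> s s0; have [] := dF s (ltW s0).
  - apply: cvg_at_right_filter; apply/differentiable_continuous.
    by apply/derivable1_diffP; have [] := dF 0 (lexx _).
  - move=> s; rewrite in_itv/= andbT => s0.
    by rewrite derive1E; have [_ ->] := dF s (ltW s0).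
have E : (\int[leb]_s (halfline f s)%:E = (l - F 0)%:E)%E.
  rewrite EFinB -I [RHS]integral_mkcond; apply: eq_integral => s _.
  by rewrite patchE /halfline mem_setE in_itv/= andbT; case: ifP.
split; last by rewrite /Rintegral E.
apply: ge0_integrable; first exact: measurable_halfline.
- by move=> s; rewrite /halfline; case: ifP => // /f0.
- by rewrite E ltry.
Qed.

Lemma cvg_inv_pinfty (c : R) : (s + c)^-1 @[s --> +oo] --> 0.
Proof.
apply/cvgrPdist_le => /= e e0; near=> s.
have s0 : e^-1 <= s + c by rewrite -lerBlDr; near: s; exact: (nbhs_pinfty_ge (num_real _)).
have sc0 : 0 < s + c by rewrite (lt_le_trans _ s0)// invr_gt0.
by rewrite sub0r normrN gtr0_norm ?invr_gt0// -[e]invrK lef_pV2 ?posrE ?invr_gt0.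
Unshelve. all: by end_near. Qed.

Lemma halfline_rational (c : R) : 0 < c ->
  leb.-integrable setT (EFin \o halfline (fun s => ((s + c) ^+ 2)^-1)) /\
  \int[leb]_s halfline (fun s => ((s + c) ^+ 2)^-1) s = c^-1.
Proof.
move=> c0; rewrite -[X in _ = X]opprK -sub0r.
rewrite -[c in X in _ = _ - X]add0r.
have sc s : 0 <= s -> s + c != 0 by move=> s0; rewrite gt_eqF// ltr_wpDl.
apply: (@halfline_FTC _ (fun s => - (s + c)^-1)).
- by move=> s s0; rewrite invr_ge0 sqr_ge0.
- move=> s s0; have sc0 := sc s s0.
  have dN : is_derive s 1 (fun s : R => s + c) 1.
    by apply: trigger_derive; rewrite addr0.
  have := is_deriveN (@is_deriveV _ (fun s => s + c) s 1 1 sc0 dN).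
  move=> d; apply: (is_derive_eq d).
  by rewrite scaleNr opprK /GRing.scale/= mulr1.
- move=> s s0; apply: cvgV; first by rewrite expf_neq0// sc.
  apply: (@continuous_comp _ _ _ (fun s : R => s + c) (fun b => b ^+ 2)).
    by apply: cvgD => //; exact: cvg_cst.
  exact: exprn_continuous.
- by rewrite -oppr0; apply: cvgN; exact: cvg_inv_pinfty.
Qed.

Lemma halfline_gamma2 (q : R) : 0 < q ->
  leb.-integrable setT (EFin \o halfline (fun s => s * expR (- (s * q)))) /\
  \int[leb]_s halfline (fun s => s * expR (- (s * q))) s = (q ^+ 2)^-1.
Proof.
move=> q0.
pose F s := - ((s / q + (q ^+ 2)^-1) * expR (- (s * q))).
have -> : (q ^+ 2)^-1 = 0 - F 0.
  by rewrite /F !mul0r !add0r oppr0 expR0 mulr1 opprK.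
apply: halfline_FTC.
- by move=> s s0; rewrite mulr_ge0// expR_ge0.
- move=> s _; rewrite /F; apply: trigger_derive.
  by rewrite /GRing.scale/=; field; rewrite gt_eqF.
- move=> s _; apply: cvgM => //; apply: continuous_comp; last exact: continuous_expR.
  by apply: cvgN; apply: cvgMl.
- rewrite -oppr0; apply: cvgN.
  have c0 : (4 / q ^+ 3) * (s + 0)^-1 @[s --> +oo] --> (0 : R).
    by rewrite -[X in _ --> X](mulr0 (4 / q ^+ 3)); apply: cvgMr;
      exact: cvg_inv_pinfty.
  apply: (@squeeze_cvgr _ _ _ _ (cst 0) _ _ _ _ _ c0).
  - near=> s; have s1 : 1 <= s by near: s; exact: (nbhs_pinfty_ge (num_real _)).
    have s0 : 0 < s by rewrite (lt_le_trans _ s1).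
    have sq0 : 0 <= s * q by rewrite mulr_ge0 ?ltW.
    have e0 : 0 <= (s / q + (q ^+ 2)^-1) * expR (- (s * q)).
      rewrite mulr_ge0 ?expR_ge0// addr_ge0 ?invr_ge0 ?sqr_ge0//.
      by rewrite divr_ge0 ?ltW.
    rewrite e0 addr0/= expRN ler_pdivrMr ?expR_gt0//.
    have h : (1 + s * q / 2) ^+ 2 <= expR (s * q).
      have v0 : 0 <= s * q / 2 by rewrite divr_ge0.
      apply: le_trans (exp_ge_pow 2 v0) _; rewrite ler_expR; lra.
    (* the square of 1 + s q / 2 beats the linear factor s / q + q ^- 2 by s *)
    apply: (@le_trans _ _ (4 / q ^+ 3 / s * (1 + s * q / 2) ^+ 2)); last first.
      by apply: ler_wpM2l h; rewrite !divr_ge0 ?exprn_ge0 ?ltW.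
    rewrite -subr_ge0.
    rewrite (_ : _ - _ = 4 / (q ^+ 3 * s) + 3 / q ^+ 2).
      by rewrite addr_ge0 ?divr_ge0 ?mulr_ge0 ?exprn_ge0 ?ltW.
    by field; rewrite !gt_eqF.
  - exact: cvg_cst.
Unshelve. all: by end_near. Qed.

End half_line.

Section riesz_kernel.
Variable R : realType.
Notation leb := (@lebesgue_measure R).
Notation mu3 := (mu3 R).
Implicit Types (i : 'I_3) (t a s : R) (x y xi : space3 R).

Definition rweight i t xi : R :=
  weight (val i == 0)%N (val i == 1)%N (val i == 2)%N t xi.

Definition rkernel i t x y : R :=
  kernel (val i == 0)%N (val i == 1)%N (val i == 2)%N t x y.

Definition gauss3 t xi : R := weight false false false t xi.

Definition nsq xi : R := xi.1.1 ^+ 2 + xi.1.2 ^+ 2 + xi.2 ^+ 2.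

Lemma nsq_ge0 xi : 0 <= nsq xi.
Proof. by rewrite !addr_ge0 ?sqr_ge0. Qed.

Lemma gauss3E t xi : gauss3 t xi = expR (- (t * nsq xi)).
Proof.
rewrite /gauss3 /weight /gmom /= !mul1r -!expRD; congr expR.
by rewrite /nsq; ring.
Qed.

Lemma rweightE i t xi : rweight i t xi = coord3 i xi ^+ 4 * gauss3 t xi.
Proof.
rewrite /rweight /gauss3 /weight /gmom /coord3.
by case: i => [[|[|[|//]]] ?] /=; ring.
Qed.

Lemma gauss3D s a xi : gauss3 (s + a) xi = expR (- (s * nsq xi)) * gauss3 a xi.
Proof. by rewrite !gauss3E -expRD; congr expR; ring. Qed.

Lemma coord3_sqr_le i xi : coord3 i xi ^+ 2 <= nsq xi.
Proof.
have := sqr_ge0 xi.1.1; have := sqr_ge0 xi.1.2; have := sqr_ge0 xi.2.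
rewrite /coord3 /nsq.
by case: i => [[|[|[|//]]] ?] /=; lra.
Qed.

Lemma norm3X4 xi : norm3 xi ^+ 4 = nsq xi ^+ 2.
Proof. by rewrite norm3E (exprM _ 2 2) sqr_sqrtr// nsq_ge0. Qed.

(** The symbol of the fourth power of the Riesz transform, as a real number. *)
Definition rsymbol i xi : R := coord3 i xi ^+ 4 / norm3 xi ^+ 4.

Lemma rsymbol_ge0 i xi : 0 <= rsymbol i xi.
Proof. by rewrite /rsymbol divr_ge0// ?norm3X4 ?sqr_ge0// (exprM _ 2 2) sqr_ge0. Qed.

Lemma rsymbol_le1 i xi : rsymbol i xi <= 1.
Proof.
rewrite /rsymbol norm3X4 (exprM _ 2 2).
have [q0|q0] := eqVneq (nsq xi) 0; first by rewrite q0 expr0n/= invr0 mulr0.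
rewrite ler_pdivrMr ?mul1r ?exprn_gt0 ?lt0r ?q0 ?nsq_ge0//.
by rewrite lerXn2r ?nnegrE ?sqr_ge0 ?nsq_ge0 ?coord3_sqr_le.
Qed.

(** This is 1 / q ^ 2 = \int_0^oo s exp (- s q) ds for q the square of the norm
    of xi. At xi = 0 both sides vanish. *)
Lemma rsymbol_superposition i a xi :
  leb.-integrable setT
    (EFin \o halfline (fun s => s * rweight i (s + a) xi)) /\
  \int[leb]_s halfline (fun s => s * rweight i (s + a) xi) s =
  rsymbol i xi * gauss3 a xi.
Proof.
have E : halfline (fun s => s * rweight i (s + a) xi) =
    (fun s => (coord3 i xi ^+ 4 * gauss3 a xi) *
      halfline (fun s => s * expR (- (s * nsq xi))) s).
  apply/funext => s; rewrite /halfline; case: ifP => _; last by rewrite mulr0.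
  by rewrite rweightE gauss3D; ring.
have [q0|q0] := eqVneq (nsq xi) 0.
  have c0 : coord3 i xi = 0.
    have := coord3_sqr_le i xi; rewrite q0 => h; apply/eqP.
    by rewrite -sqrf_eq0 eq_le h sqr_ge0.
  rewrite E /rsymbol c0 expr0n/= !mul0r.
  under [in X in X /\ _]eq_fun do rewrite mul0r.
  under eq_Rintegral do rewrite mul0r.
  by rewrite Rintegral_cst// mul0r; split => //; exact: integrable0.
have qp : 0 < nsq xi by rewrite lt0r q0 nsq_ge0.
have [I1 I2] := halfline_gamma2 qp.
rewrite E; split; first exact: integrable_scale.
by rewrite RintegralZl// I2 /rsymbol norm3X4 mulrAC.
Qed.

Lemma measurable_rweight i a :
  measurable_fun setT (fun z : space3 R * R => rweight i (z.2 + a) z.1).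
Proof.
have mf := @measurable_fst _ _ (space3 R) (measurableTypeR R).
have ms := @measurable_snd _ _ (space3 R) (measurableTypeR R).
have mg n (p : space3 R -> R) : measurable_fun setT p ->
    measurable_fun setT (fun z : space3 R * measurableTypeR R =>
      gmom n (z.2 + a) (p z.1)).
  move=> mp; have mp1 := measurableT_comp mp mf.
  apply: measurable_funM; first exact: measurable_funX.
  apply: (measurableT_comp (@measurable_expR R)).
  apply: measurableT_comp => //; apply: measurable_funM.
    exact: measurable_funD.
  exact: measurable_funX.
apply: measurable_funM; first apply: measurable_funM.
- exact: (mg _ _ (@measurable_coord1 R)).
- exact: (mg _ _ (@measurable_coord2 R)).
- exact: (mg _ _ (@measurable_coord3 R)).
Qed.

Lemma measurable_hrweight i a :
  measurable_fun setT (fun z : space3 R * measurableTypeR R =>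
    halfline (fun s => s * rweight i (s + a) z.1) z.2).
Proof.
have ms := @measurable_snd _ _ (space3 R) (measurableTypeR R).
rewrite (_ : (fun z => _) = fun z : space3 R * measurableTypeR R =>
  Num.max z.2 0 * rweight i (z.2 + a) z.1).
  apply: measurable_funM; last exact: measurable_rweight.
  by apply: measurable_maxr.
apply/funext => z; rewrite /halfline; case: ifPn => [h|].
  by rewrite max_l.
by rewrite -ltNge => h; rewrite max_r ?mul0r// ltW.
Qed.

Lemma hrweight_ge0 i a xi s :
  0 <= halfline (fun s => s * rweight i (s + a) xi) s.
Proof.
by rewrite /halfline; case: ifP => // s0; rewrite mulr_ge0// weight_ge0.
Qed.

Lemma rkernel_bound i t x y c : 0 < t -> 0 < c ->
  2 * c <= (2 * pi) ^+ 2 * nsq (x - y)%R ->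
  t * `|rkernel i t x y| <= 3 * 10 ^+ 5 * pi * Num.sqrt (pi / c) / (t + c) ^+ 2.
Proof.
move=> t0 c0 h; rewrite /rkernel /kernel.
have E (b1 b2 b3 : R) : kap4 t b1 * kap0 t b2 * kap0 t b3 =
   kap0 t b2 * kap4 t b1 * kap0 t b3 by ring.
have E' (b1 b2 b3 : R) : kap4 t b1 * kap0 t b2 * kap0 t b3 =
   kap0 t b2 * kap0 t b3 * kap4 t b1 by ring.
set b1 := 2 * pi * (x.1.1 - y.1.1); set b2 := 2 * pi * (x.1.2 - y.1.2).
set b3 := 2 * pi * (x.2 - y.2).
have bE : (2 * pi) ^+ 2 * nsq (x - y)%R = b1 ^+ 2 + b2 ^+ 2 + b3 ^+ 2.
  by rewrite /nsq /b1 /b2 /b3 /=; ring.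
rewrite bE in h.
case: i => [[|[|[|//]]] ?] /=.
- exact: kap400_bound.
- by rewrite -E; apply: kap400_bound => //; lra.
- by rewrite -E'; apply: kap400_bound => //; lra.
Qed.

End riesz_kernel.

Section riesz_off_support.
Variable R : realType.
Notation leb := (@lebesgue_measure R).
Notation mu3 := (mu3 R).
Implicit Types (i : 'I_3) (a s c : R) (x y xi : space3 R).
Implicit Types (f h F : space3 R -> R[i]).

(** The constant in the bound of [kap400_bound]. *)
Definition kernel_const c : R := 3 * 10 ^+ 5 * pi * Num.sqrt (pi / c).

Lemma kernel_const_ge0 c : 0 <= kernel_const c.
Proof. by rewrite !mulr_ge0 ?exprn_ge0 ?pi_ge0 ?sqrtr_ge0. Qed.

Lemma measurable_rsymbol_gauss3 i a :
  measurable_fun setT (fun xi => rsymbol i xi * gauss3 a xi).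
Proof.
have := @measurable_fun_Rintegral _ _ _ _ _ leb _ (measurable_hrweight i a).
congr measurable_fun; apply/funext => xi /=.
by have [_ ->] := rsymbol_superposition i a xi.
Qed.

(** The superposition is exchanged with the integral in xi; for each s the
    multiplication formula then gives an integral of f against an explicit
    kernel, whose bound is integrable in s. Shifting the time from s to s + a
    only improves the bound, so the estimate is uniform in a. *)
Lemma rsymbol_pairing_bound i f F a y phi c : 0 < a -> 0 < c ->
  inLp 1 f -> is_fourierL2 f F ->
  {ae mu3, forall x, f x = 0 \/ 2 * c <= (2 * pi) ^+ 2 * nsq (x - y)%R} ->
  `|\int[mu3]_xi (rot (2 * pi * dot3 y xi - phi) (F xi) *
                  (rsymbol i xi * gauss3 a xi))| <=
  kernel_const c / c * \int[mu3]_x cmod (f x).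
Proof.
move=> a0 c0 f1 hF fc.
have [_ [F1 F2 Foo] _] := hF.
have [fm1 fm2 _] := f1.
set tau := fun xi => 2 * pi * dot3 y xi - phi.
have mtau : measurable_fun setT tau.
  apply: measurable_funB => //; apply: measurable_funM => //.
  exact: measurable_dot3r.
have mrF := measurable_rot (conj F1 F2) mtau.
have [Fi _] := normL2_integrable (conj F1 F2) Foo.
pose G (z : space3 R * measurableTypeR R) := rot (tau z.1) (F z.1) *
  halfline (fun s => s * rweight i (s + a) z.1) z.2.
have mG : measurable_fun setT G.
  apply: measurable_funM; last exact: measurable_hrweight.
  exact: (measurableT_comp mrF measurable_fst).
have GE xi : \int[leb]_s G (xi, s) =
    rot (tau xi) (F xi) * (rsymbol i xi * gauss3 a xi).
  have [I1 I2] := rsymbol_superposition i a xi.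
  by rewrite /G/= RintegralZl// I2.
have gi : mu3.-integrable setT (EFin \o (fun xi => cmod (F xi) * gauss3 a xi)).
  apply: integrable_mul_sqr => //.
  - exact: measurable_cmod.
  - exact: measurable_weight.
  - exact: integrable_weight_sqr.
have iG : (prodm mu3 leb).-integrable setT (EFin \o G).
  apply: (integrable_prod_abs mG _ _ gi) => xi.
    have [I1 _] := rsymbol_superposition i a xi.
    exact: (integrable_scale (rot (tau xi) (F xi)) I1).
  under eq_Rintegral => s _ do
    rewrite /G/= normrM [X in _ * X]ger0_norm ?hrweight_ge0//.
  have [I1 I2] := rsymbol_superposition i a xi.
  rewrite RintegralZl// I2; apply: ler_pM => //.
  - by rewrite mulr_ge0 ?rsymbol_ge0// weight_ge0.
  - exact: norm_rot_le.
  - by rewrite ler_piMl ?rsymbol_le1// weight_ge0.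
rewrite -(eq_Rintegral _ (fun xi _ => GE xi)) Fubini_real//.
have [B1 B2] := halfline_rational (addr_gt0 a0 c0).
set N1 := \int[mu3]_x cmod (f x).
have N10 : 0 <= N1 by apply: Rintegral_ge0 => x _; exact: cmod_ge0.
have K0 := kernel_const_ge0 c.
have ac0 : 0 < a + c by rewrite addr_gt0.
apply: (@le_trans _ _ (\int[leb]_s (kernel_const c * N1 *
    halfline (fun s => ((s + (a + c)) ^+ 2)^-1) s))); last first.
  rewrite RintegralZl// B2 mulrAC ler_wpM2r// ler_wpM2l//.
  by rewrite lef_pV2 ?posrE// lerDr ltW.
apply: ler_norm_Rintegral.
- apply: (@measurable_fun_Rintegral _ _ _ _ _ mu3 (fun z => G (z.2, z.1))).
  by apply: (measurableT_comp mG); apply: measurable_fun_pair.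
- exact: integrable_scale.
move=> s; rewrite /G /halfline /=; case: ifPn => s0; last first.
  by under eq_Rintegral do rewrite mulr0; rewrite Rintegral_cst// mul0r normr0 mulr0.
have sa0 : 0 < s + a by rewrite ltr_wpDl.
under eq_Rintegral do rewrite mulrCA.
rewrite RintegralZl//; last first.
  apply: integrable_rot_mul => //.
  - exact: measurable_weight.
  - exact: integrable_weight_sqr.
rewrite (fourierL2_multiplication _ _ _ _ _ sa0 hF) normrM ger0_norm//.
pose k x := rkernel i (s + a) x y.
pose C := kernel_const c / (s + a + c) ^+ 2.
have sac0 : 0 < s + a + c by rewrite addr_gt0.
have C0 : 0 <= C by rewrite divr_ge0 ?sqr_ge0.
have mk : measurable_fun setT k by exact: measurable_kernelr.
have kb : {ae mu3, forall x, `|rot (- phi) (f x) * (s * k x)| <= C * cmod (f x)}.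
  apply: filterS fc => x [->|cx].
    by rewrite /rot /= !mul0r subrr mul0r normr0 mulr_ge0// cmod_ge0.
  rewrite normrM mulrC ler_pM ?norm_rot_le//.
  have := rkernel_bound i sa0 c0 cx; rewrite -/(kernel_const c) -/C.
  apply: le_trans; rewrite normrM ger0_norm// ler_wpM2r// lerDl ltW//.
have [[fl1 fl2 foo] _ _] := hF.
have fi2 := (normL2_integrable (conj fl1 fl2) foo).1.
have irk : mu3.-integrable setT (EFin \o (fun x => rot (- phi) (f x) * k x)).
  exact: (integrable_rot_mul (conj fl1 fl2) (measurable_cst _) mk fi2
    (integrable_kernel_sqr _ _ _ y sa0)).
rewrite -[s in s * `|_|](ger0_norm s0) -normrM -RintegralZl//.
have ic : mu3.-integrable setT (EFin \o (fun x => C * cmod (f x))).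
  exact/integrable_scale/inL1_integrable.
have mrk : measurable_fun setT (fun x => rot (- phi) (f x) * (s * k x)).
  apply: measurable_funM; last exact: measurable_funM.
  exact: measurable_rot.
have [_] := ae_ler_norm_Rintegral mrk ic kb.
rewrite RintegralZl//; last exact: inL1_integrable.
under eq_Rintegral do rewrite mulrCA.
by move=> /le_trans; apply; rewrite /C addrA mulrAC -/N1 mulrAC.
Qed.

End riesz_off_support.

Section riesz_heat.
Variable R : realType.
Notation mu3 := (mu3 R).

(** Testing h against a heat kernel centred at y amounts to testing its
    transform against a Gaussian times a character. *)
Lemma riesz4_heat_bound (i : 'I_3) (f h : space3 R -> R[i]) (a c phi : R)
    (y : space3 R) : 0 < a -> 0 < c -> inLp 1 f -> is_riesz4 i f h ->
  {ae mu3, forall x, f x = 0 \/ 2 * c <= (2 * pi) ^+ 2 * nsq (x - y)%R} ->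
  `|\int[mu3]_x (rot (- phi) (h x) * heat a x y)| <=
  kernel_const c / c * \int[mu3]_x cmod (f x).
Proof.
move=> a0 c0 f1 [F [H [hF hH HF]]] fc.
rewrite -(fourierL2_multiplication false false false y phi a0 hH).
have [_ [F1 F2 _] _] := hF; have [_ [H1 H2 _] _] := hH.
have mt : measurable_fun setT (fun xi => 2 * pi * dot3 y xi - phi).
  apply: measurable_funB => //; apply: measurable_funM => //.
  exact: measurable_dot3r.
have mrF := measurable_rot (conj F1 F2) mt.
have mrH := measurable_rot (conj H1 H2) mt.
rewrite (_ : \int[mu3]_xi _ = \int[mu3]_xi
  (rot (2 * pi * dot3 y xi - phi) (F xi) * (rsymbol i xi * gauss3 a xi))).
  exact: rsymbol_pairing_bound.
apply: ae_eq_Rintegral.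
- by apply: measurable_funM => //; exact: measurable_weight.
- by apply: measurable_funM => //; exact: measurable_rsymbol_gauss3.
apply: filterS HF => xi ->.
rewrite /riesz4_symbol -/(rsymbol i xi) /gauss3 mulrA; congr (_ * _).
by case: (F xi) => p q; rewrite /rot/=; ring.
Qed.

End riesz_heat.

(** * The heat kernel as an approximate identity *)

Lemma prodmE d1 d2 (T1 : measurableType d1) (T2 : measurableType d2)
    (R : realType) (m1 : {sigma_finite_measure set T1 -> \bar R})
    (m2 : {sigma_finite_measure set T2 -> \bar R}) A B :
  measurable A -> measurable B -> prodm m1 m2 (A `*` B) = (m1 A * m2 B)%E.
Proof. by move=> mA mB; rewrite /prodm product_measure1E. Qed.

Section approximate_identity.
Variable R : realType.
Notation leb := (@lebesgue_measure R).
Notation mu3 := (mu3 R).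
Implicit Types (x y : space3 R) (a d : R) (A B E Q : set (space3 R)).

Definition near3 d x y : Prop :=
  [/\ `|x.1.1 - y.1.1| < d, `|x.1.2 - y.1.2| < d & `|x.2 - y.2| < d].

(** In topological terms: x is not on the boundary of B. *)
Definition off_boundary B x : Prop :=
  exists2 d, 0 < d & forall y, near3 d x y -> (B y <-> B x).

(** The measurable sets with negligible boundary. *)
Definition regular B : Prop :=
  measurable B /\ {ae mu3, forall x, off_boundary B x}.

Lemma regularI A B : regular A -> regular B -> regular (A `&` B).
Proof.
move=> [mA rA] [mB rB]; split; first exact: measurableI.
apply: filterS2 rA rB => x [d d0 hd] [e e0 he].
exists (Num.min d e) => [|y [y1 y2 y3]]; first by rewrite lt_min d0.
rewrite !lt_min in y1 y2 y3.
case/andP: y1 => y1 y1'; case/andP: y2 => y2 y2'; case/andP: y3 => y3 y3'.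
have := hd y; have := he y; rewrite /near3 => /(_ _)/wrap[//|h1] /(_ _)/wrap[//|h2].
by split => -[/h2 ? /h1 ?].
Qed.

Lemma regularC A : regular A -> regular (~` A).
Proof.
move=> [mA rA]; split; first exact: measurableC.
apply: filterS rA => x [d d0 hd]; exists d => // y /hd[h1 h2].
by split => nA ?; apply: nA; [exact: h2|exact: h1].
Qed.

Lemma mu3E (A B C : set R) : measurable A -> measurable B -> measurable C ->
  mu3 ((A `*` B) `*` C) = (leb A * leb B * leb C)%E.
Proof.
move=> mA mB mC; apply: (etrans (prodmE _ _ _ _)) => //.
  exact: measurableX.
by congr (_ * _)%E; exact: prodmE.
Qed.

Lemma ae_mu3_coord1_neq (b : R) : {ae mu3, forall x, x.1.1 != b}.
Proof.
exists (([set b] `*` setT) `*` setT); split.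
- by apply: measurableX => //; apply: measurableX.
- by apply: (etrans (mu3E _ _ _)) => //; rewrite lebesgue_measure_set1 !mul0e.
- by move=> -[[u v] w] /= /negP; rewrite negbK => /eqP ->.
Qed.

Lemma ae_mu3_coord2_neq (b : R) : {ae mu3, forall x, x.1.2 != b}.
Proof.
exists ((setT `*` [set b]) `*` setT); split.
- by apply: measurableX => //; apply: measurableX.
- apply: (etrans (mu3E _ _ _)) => //.
  by rewrite lebesgue_measure_set1 mule0 mul0e.
- by move=> -[[u v] w] /= /negP; rewrite negbK => /eqP ->.
Qed.

Lemma ae_mu3_coord3_neq (b : R) : {ae mu3, forall x, x.2 != b}.
Proof.
exists ((setT `*` setT) `*` [set b]); split.
- by apply: measurableX => //; apply: measurableX.
- by apply: (etrans (mu3E _ _ _)) => //; rewrite lebesgue_measure_set1 mule0.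
- by move=> -[[u v] w] /= /negP; rewrite negbK => /eqP ->.
Qed.

Lemma regular_ray (p : space3 R -> R) (b : R) : measurable_fun setT p ->
  (forall d x y, near3 d x y -> `|p x - p y| < d) ->
  {ae mu3, forall x, p x != b} -> regular [set x | p x <= b].
Proof.
move=> mp np pb; split.
  rewrite (_ : [set x | p x <= b] = setT `&` p @^-1` `]-oo, b]%classic).
    exact: mp.
  by apply/seteqP; split => x /=; rewrite in_itv/=; tauto.
apply: filterS pb => x xb; exists `|p x - b|.
  by rewrite normr_gt0 subr_eq0.
move=> y /np /=; have [h|h|h] := ltgtP (p x) b.
- by rewrite (ltr0_norm (_ : p x - b < 0)) ?subr_lt0// ltr_norml => /andP[h1 _];
    split => // _; lra.
- by rewrite (gtr0_norm (_ : 0 < p x - b)) ?subr_gt0// ltr_norml => /andP[_ h1];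
    split => // h2; lra.
- by rewrite h eqxx in xb.
Qed.

Lemma regular_ray1 b : regular [set x | x.1.1 <= b].
Proof.
apply: regular_ray (@measurable_coord1 R) _ (ae_mu3_coord1_neq b).
by move=> d x y [].
Qed.

Lemma regular_ray2 b : regular [set x | x.1.2 <= b].
Proof.
apply: regular_ray (@measurable_coord2 R) _ (ae_mu3_coord2_neq b).
by move=> d x y [].
Qed.

Lemma regular_ray3 b : regular [set x | x.2 <= b].
Proof.
apply: regular_ray (@measurable_coord3 R) _ (ae_mu3_coord3_neq b).
by move=> d x y [].
Qed.

(** Half-spaces orthogonal to the axes are regular, so the coordinates, and
    with them the identity, are measurable for the sigma-algebra generated by
    the regular sets. *)
Lemma measurable_regularE : @measurable _ (space3 R) = <<s regular >>.
Proof.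
rewrite eqEsubset; split; last first.
  apply: smallest_sub; last by move=> B [].
  exact: sigma_algebra_measurable.
have mp (p : space3 R -> R) : (forall b, regular [set x | p x <= b]) ->
    measurable_fun (setT : set (g_sigma_algebraType regular)) p.
  move=> rp; apply: (measurability (@ocitv R)) => //.
  move=> _ [_ [[a b] _ <-] <-]; rewrite setTI; apply: sub_sigma_algebra.
  rewrite (_ : _ @^-1` _ = [set x | p x <= b] `&` ~` [set x | p x <= a]).
    by apply: regularI => //; exact: regularC.
  apply/seteqP; split => x /=; rewrite in_itv/=.
    by move=> /andP[h1 h2]; split => //; apply/negP; rewrite -ltNge.
  by move=> [h1 /negP]; rewrite -ltNge h1 => ->.
have m1 := mp _ regular_ray1; have m2 := mp _ regular_ray2.
have m3 := mp _ regular_ray3.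
have mid : measurable_fun (setT : set (g_sigma_algebraType regular))
    (fun x : space3 R => ((x.1.1, x.1.2), x.2) : space3 R).
  by apply: measurable_fun_pair => //; exact: measurable_fun_pair.
move=> A mA; have := mid measurableT A mA; rewrite setTI.
by congr (<<s _ >> _); apply/seteqP; split => -[[u v] w].
Qed.

Lemma regular_setI_closed : setI_closed regular.
Proof. by move=> A B; exact: regularI. Qed.

End approximate_identity.

(** The sets on which convergence holds form a Dynkin system: in a disjoint
    union the tail is uniformly small, because a finite measure dominates. *)
Lemma dominated_setwise_cvg d (T : measurableType d) (R : realType)
    (rho : {measure set T -> \bar R}) (G : set (set T))
    (L : nat -> set T -> R) (l : set T -> R) :
  (rho setT < +oo)%E -> @measurable _ T = <<s G >> -> setI_closed G ->
  (forall n A B, measurable A -> measurable B -> A `&` B = set0 ->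
    L n (A `|` B) = L n A + L n B) ->
  (forall A B, measurable A -> measurable B -> A `&` B = set0 ->
    l (A `|` B) = l A + l B) ->
  (forall n A, measurable A -> 0 <= L n A <= fine (rho A)) ->
  (forall A, measurable A -> 0 <= l A <= fine (rho A)) ->
  L n setT @[n --> \oo] --> l setT ->
  (forall A, G A -> L n A @[n --> \oo] --> l A) ->
  forall A, measurable A -> L n A @[n --> \oo] --> l A.
Proof.
move=> rhoT GE GI Ladd ladd Lle lle cT cG A; rewrite GE.
have rfin B : measurable B -> rho B \is a fin_num.
  move=> mB; rewrite ge0_fin_numE//; apply: le_lt_trans rhoT.
  by apply: le_measure; rewrite ?inE.
apply: (dynkin_induction GE GI cT cG) => [S mS cS|F mF tF cF].
- have compl (f : set T -> R) : (forall A B, measurable A -> measurable B ->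
      A `&` B = set0 -> f (A `|` B) = f A + f B) -> f (~` S) = f setT - f S.
    move=> fadd; have := fadd S (~` S) mS (measurableC mS) (setICr S).
    by rewrite setUv; lra.
  rewrite (compl l ladd).
  under eq_fun => n do rewrite (compl (L n) (Ladd n)).
  exact: cvgB.
- set U := \bigcup_k F k.
  have mU : measurable U by exact: bigcup_measurable.
  pose V N := \big[setU/set0]_(i < N) F i.
  have mV N : measurable (V N) by exact: bigsetU_measurable.
  have VU N : V N `<=` U by exact: bigsetU_bigcup.
  have split_ (f : set T -> R) N : (forall A B, measurable A -> measurable B ->
      A `&` B = set0 -> f (A `|` B) = f A + f B) ->
      f U = f (V N) + f (U `\` V N).
    move=> fadd; rewrite -fadd ?setDIK//; last exact: measurableD.
    by rewrite setDUK.
  have radd A' B' : measurable A' -> measurable B' -> A' `&` B' = set0 ->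
      fine (rho (A' `|` B')) = fine (rho A') + fine (rho B').
    move=> mA' mB' AB; rewrite measureU// fineD//; exact: rfin.
  have cV N : L n (V N) @[n --> \oo] --> l (V N).
    elim: N => [|N IH].
      have l0 (f : set T -> R) : (forall A B, measurable A -> measurable B ->
          A `&` B = set0 -> f (A `|` B) = f A + f B) -> f set0 = 0.
        move=> fadd; have := fadd set0 set0 measurable0 measurable0 (setI0 _).
        by rewrite setU0 => /eqP; rewrite -subr_eq0 opprD addrA subrr add0r
          oppr_eq0 => /eqP.
      rewrite /V big_ord0 (l0 l ladd).
      under eq_fun => n do rewrite (l0 (L n) (Ladd n)).
      exact: cvg_cst.
    have VF : V N `&` F N = set0.
      by apply: (@trivIset_bigsetUI _ predT) => //; rewrite /predT/= trueE.
    have VS f : (forall A B, measurable A -> measurable B ->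
        A `&` B = set0 -> f (A `|` B) = f A + f B) ->
        f (V N.+1) = f (V N) + f (F N) :> R.
      by move=> fadd; rewrite /V big_ord_recr/= fadd//; exact: mV.
    rewrite (VS l ladd); under eq_fun => n do rewrite (VS (L n) (Ladd n)).
    exact: cvgD.
  have cr : fine (rho (U `\` V N)) @[N --> \oo] --> (0 : R).
    have -> : (fun N => fine (rho (U `\` V N))) =
        (fun N => fine (rho U) - fine (rho (V N))).
      apply/funext => N; have := split_ (fine \o rho) N radd.
      by rewrite /=; lra.
    rewrite -(subrr (fine (rho U))); apply: cvgB; first exact: cvg_cst.
    apply: fine_cvg; rewrite fineK ?rfin//.
    have -> : (fun N => rho (V N)) = (fun N => \sum_(0 <= i < N) rho (F i))%E.
      by apply/funext => N; rewrite measure_bigsetU// big_mkord.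
    exact: measure_sigma_additive.
  apply/cvgrPdist_le => /= e e0.
  have e3 : 0 < e / 3 by rewrite divr_gt0.
  have /cvgrPdist_le /(_ _ e3)[N _ /(_ N (leqnn N)) hN] := cr.
  have {}hN : fine (rho (U `\` V N)) <= e / 3.
    by move: hN; rewrite /= sub0r normrN; apply: le_trans; exact: ler_norm.
  near=> n.
  have hV : `|l (V N) - L n (V N)| <= e / 3.
    by near: n; move/cvgrPdist_le : (cV N); exact.
  have mD : measurable (U `\` V N) by exact: measurableD.
  have := Lle n _ mD; have := lle _ mD.
  move: hV; rewrite (split_ l N ladd) (split_ (L n) N (Ladd n)) !ler_norml.
  move=> /andP[h1 h2] /andP[h3 h4] /andP[h5 h6].
  by apply/andP; split; lra.
Unshelve. all: by end_near. Qed.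

Section heat_average.
Variable R : realType.
Notation leb := (@lebesgue_measure R).
Notation mu3 := (mu3 R).
Implicit Types (x y : space3 R) (a d : R) (A B E Q : set (space3 R)).

(** The convolution of the indicator of B with the heat kernel. *)
Definition avg a B x : R := \int[mu3]_y (heat a y x * \1_B y).

Lemma norm_indic_le1 B x : `|\1_B x : R| <= 1.
Proof. by rewrite indicE; case: (x \in B); rewrite ?normr1 ?normr0. Qed.

Lemma indic_ge0 B x : 0 <= \1_B x :> R.
Proof. by rewrite indicE; case: (x \in B). Qed.

Lemma integrable_indicR B : measurable B -> (mu3 B < +oo)%E ->
  mu3.-integrable setT (EFin \o (\1_B : space3 R -> R)).
Proof.
move=> mB Boo; apply: ge0_integrable => [|x|]; first exact: measurable_indic.
  exact: indic_ge0.
by rewrite integral_indic// setIT.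
Qed.

Lemma Rintegral_indic B : measurable B ->
  \int[mu3]_x (\1_B x : R) = fine (mu3 B).
Proof. by move=> mB; rewrite /Rintegral integral_indic// setIT. Qed.

Lemma integrable_heat_indic a B x : 0 < a -> measurable B ->
  mu3.-integrable setT (EFin \o (fun y => heat a y x * \1_B y)).
Proof.
move=> a0 mB; apply: (@integrable_mul_bounded _ _ _ _ 1).
- exact: measurable_indic.
- exact: norm_indic_le1.
- exact: integrable_heat.
Qed.

Lemma avg_ge0 a B x : 0 <= avg a B x.
Proof.
by apply: Rintegral_ge0 => y _; rewrite mulr_ge0 ?heat_ge0 ?indic_ge0.
Qed.

Lemma avg_le1 a B x : 0 < a -> measurable B -> avg a B x <= 1.
Proof.
move=> a0 mB; rewrite -(Rintegral_heat x a0); apply: le_Rintegral => //.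
- exact: integrable_heat_indic.
- exact: integrable_heat.
- by move=> y _; rewrite ler_piMr ?heat_ge0.
Qed.

Lemma measurable_heat a : measurable_fun setT
  (fun z : space3 R * space3 R => heat a z.1 z.2).
Proof. exact: measurable_kernel. Qed.

Lemma measurable_avg a B : measurable B -> measurable_fun setT (avg a B).
Proof.
move=> mB; apply: (@measurable_fun_Rintegral _ _ _ _ _ mu3
  (fun z => heat a z.2 z.1 * \1_B z.2)).
have ms := @measurable_snd _ _ (space3 R) (space3 R).
apply: measurable_funM.
  under eq_fun do rewrite heatC; exact: measurable_heat.
exact: (measurableT_comp (measurable_indic mB) ms).
Qed.

Lemma indicU_disjoint A B y : A `&` B = set0 ->
  \1_(A `|` B) y = \1_A y + \1_B y :> R.
Proof.
move=> AB; rewrite !indicE in_setU.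
have [yA|yA] := boolP (y \in A); have [yB|yB] := boolP (y \in B) => //=;
  rewrite ?addr0 ?add0r//.
by have : set0 y by rewrite -AB; split; exact/set_mem.
Qed.

Lemma avgU a A B x : 0 < a -> measurable A -> measurable B -> A `&` B = set0 ->
  avg a (A `|` B) x = avg a A x + avg a B x.
Proof.
move=> a0 mA mB AB; rewrite /avg -RintegralD//; try exact: integrable_heat_indic.
apply: eq_Rintegral => y _; rewrite -mulrDr; congr (_ * _).
exact: indicU_disjoint.
Qed.

(** Away from the cube around x one of the three factors exp (- b_j ^ 2 / (8 a))
    split off by doubling the time is small. *)
Lemma heat_far a d x y : 0 < a -> 0 < d -> ~ near3 d x y ->
  heat a y x <= Num.sqrt 2 ^+ 3 * expR (- (pi ^+ 2 * d ^+ 2 / (2 * a))) *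
    heat (2 * a) y x.
Proof.
move=> a0 d0 nf; rewrite /heat /kernel /=.
set b1 := 2 * pi * (y.1.1 - x.1.1); set b2 := 2 * pi * (y.1.2 - x.1.2).
set b3 := 2 * pi * (y.2 - x.2).
have far : pi ^+ 2 * d ^+ 2 / (2 * a) <= (b1 ^+ 2 + b2 ^+ 2 + b3 ^+ 2) / (8 * a).
  have an0 : a != 0 by rewrite gt_eqF.
  rewrite (_ : _ / (2 * a) = (2 * pi) ^+ 2 * d ^+ 2 / (8 * a)); last first.
    by move: (pi : R) => p; field.
  rewrite ler_wpM2r ?invr_ge0 ?mulr_ge0 ?(ltW a0)//.
  have sq (u v : R) : ~ (`|u - v| < d) -> d ^+ 2 <= (v - u) ^+ 2.
    move=> /negP; rewrite -leNgt distrC => h.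
    by rewrite -(real_normK (num_real (v - u))) lerXn2r ?nnegrE// ltW.
  have p2 : 0 <= (2 * pi : R) ^+ 2 by exact: sqr_ge0.
  have sqE (u : R) : (2 * pi * u) ^+ 2 = (2 * pi) ^+ 2 * u ^+ 2.
    by rewrite exprMn.
  rewrite /b1 /b2 /b3 !sqE -!mulrDr ler_wpM2l//.
  have h1 := sqr_ge0 (y.1.1 - x.1.1); have h2 := sqr_ge0 (y.1.2 - x.1.2).
  have h3 := sqr_ge0 (y.2 - x.2).
  have [k1|/sq k1] := pselect (`|x.1.1 - y.1.1| < d); last by lra.
  have [k2|/sq k2] := pselect (`|x.1.2 - y.1.2| < d); last by lra.
  have [k3|/sq k3] := pselect (`|x.2 - y.2| < d); last by lra.
  by case: nf.
rewrite (kap0_double b1 a0) (kap0_double b2 a0) (kap0_double b3 a0).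
set k1 := kap0 _ b1; set k2 := kap0 _ b2; set k3 := kap0 _ b3.
have eE : expR (- ((b1 ^+ 2 + b2 ^+ 2 + b3 ^+ 2) / (8 * a))) =
    expR (- (b1 ^+ 2 / (8 * a))) * expR (- (b2 ^+ 2 / (8 * a))) *
    expR (- (b3 ^+ 2 / (8 * a))).
  by rewrite -!expRD; congr expR; ring.
apply: (@le_trans _ _ (Num.sqrt 2 ^+ 3 * (k1 * k2 * k3) *
   expR (- ((b1 ^+ 2 + b2 ^+ 2 + b3 ^+ 2) / (8 * a))))).
  rewrite eE le_eqVlt; apply/orP; left; apply/eqP.
  move: (Num.sqrt 2) (expR _) (expR _) (expR _) => q p1 p2 p3; ring.
rewrite [leRHS]mulrAC ler_wpM2l//; last by rewrite ler_expR lerN2.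
by rewrite !mulr_ge0 ?sqrtr_ge0 ?exprn_ge0 ?kap0_ge0.
Qed.

(** The indicator of B differs from its value at x only away from the cube
    around x. *)
Lemma avg_off_boundary a d B x : 0 < a -> 0 < d -> measurable B ->
  (forall y, near3 d x y -> (B y <-> B x)) ->
  `|avg a B x - \1_B x| <=
  Num.sqrt 2 ^+ 3 * expR (- (pi ^+ 2 * d ^+ 2 / (2 * a))).
Proof.
move=> a0 d0 mB hB; set C := _ * expR _.
have C0 : 0 <= C by rewrite mulr_ge0 ?expR_ge0 ?exprn_ge0 ?sqrtr_ge0.
have a20 : 0 < 2 * a by rewrite mulr_gt0.
rewrite -[\1_B x]mul1r -(Rintegral_heat x a0) -RintegralZr//; last first.
  exact: integrable_heat.
rewrite /avg -RintegralB//; last 2 first.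
- exact: integrable_heat_indic.
- under eq_fun do rewrite mulrC; exact/integrable_scale/integrable_heat.
rewrite -[C]mulr1 -(Rintegral_heat x a20) -RintegralZl//; last first.
  exact: integrable_heat.
apply: ler_norm_Rintegral.
- apply: measurable_funB; apply: measurable_funM => //;
    first [exact: measurable_kernelr | exact: measurable_indic].
- exact/integrable_scale/integrable_heat.
move=> y; rewrite -mulrBr normrM (ger0_norm (heat_ge0 _ _ _)).
have [nr|nr] := pselect (near3 d x y).
  have -> : \1_B y = \1_B x :> R.
    have [h1 h2] := hB _ nr; rewrite !indicE; congr (_ %:R).
    by congr nat_of_bool; apply/idP/idP => /set_mem ?; apply/mem_set; auto.
  by rewrite subrr normr0 mulr0 mulr_ge0 ?heat_ge0.
apply: (le_trans _ (heat_far a0 d0 nr)); rewrite ler_piMr ?heat_ge0//.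
by rewrite !indicE; case: (y \in B); case: (x \in B);
  rewrite ?subrr ?subr0 ?sub0r ?normrN ?normr1 ?normr0.
Qed.

Lemma cvg_expR_harmonic (K : R) : 0 < K ->
  expR (- (K / n.+1%:R^-1)) @[n --> \oo] --> (0 : R).
Proof.
move=> K0.
have Nc : K^-1 * n.+1%:R^-1 @[n --> \oo] --> (0 : R).
  by rewrite -[X in _ --> X](mulr0 K^-1); apply: cvgMr; exact: cvg_harmonic.
apply: (@squeeze_cvgr _ _ _ _ (cst 0) _ _ _ _ _ Nc); last exact: cvg_cst.
apply: nearW => n; rewrite expR_ge0/= invrK expRN -invfM.
have n0 : 0 < n.+1%:R :> R by rewrite ltr0n.
rewrite lef_pV2 ?posrE ?expR_gt0 ?mulr_gt0//.
by apply: le_trans (expR_ge1Dx _); rewrite lerDr.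
Qed.

Lemma avg_cvg B x : measurable B -> off_boundary B x ->
  avg n.+1%:R^-1 B x @[n --> \oo] --> (\1_B x : R).
Proof.
move=> mB [d d0 hB]; apply/subr_cvg0; apply: norm_cvg0.
have K0 : 0 < pi ^+ 2 * d ^+ 2 / 2 :> R.
  by rewrite !(divr_gt0, mulr_gt0, exprn_gt0)// pi_gt0.
have Nc : Num.sqrt 2 ^+ 3 *
    expR (- (pi ^+ 2 * d ^+ 2 / 2 / n.+1%:R^-1)) @[n --> \oo] --> (0 : R).
  by rewrite -[X in _ --> X](mulr0 (Num.sqrt 2 ^+ 3)); apply: cvgMr;
    exact: cvg_expR_harmonic.
apply: (@squeeze_cvgr _ _ _ _ (cst 0) _ _ _ _ _ Nc); last exact: cvg_cst.
apply: nearW => n; rewrite normr_ge0/=.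
have := @avg_off_boundary n.+1%:R^-1 d B x.
by rewrite invfM mulrA; apply.
Qed.

End heat_average.

Section heat_overlap.
Variable R : realType.
Notation leb := (@lebesgue_measure R).
Notation mu3 := (mu3 R).
Implicit Types (x y : space3 R) (a d : R) (A B E Q : set (space3 R)).

Lemma heat_le a x y : 0 < a -> heat a x y <= Num.sqrt (pi / a) ^+ 3.
Proof.
move=> a0; have k b : kap0 a b <= Num.sqrt (pi / a).
  rewrite /kap0 ler_piMr ?sqrtr_ge0// -expR0 ler_expR oppr_le0.
  by rewrite mulr_ge0 ?sqr_ge0// invr_ge0 mulr_ge0// ltW.
rewrite /heat /kernel /= !exprS expr0 mulr1 mulrA.
by rewrite !ler_pM ?mulr_ge0 ?kap0_ge0.
Qed.

Lemma integrable_indic_avg a A B : 0 < a -> measurable A -> (mu3 A < +oo)%E ->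
  measurable B -> mu3.-integrable setT (EFin \o (fun x => \1_A x * avg a B x)).
Proof.
move=> a0 mA Aoo mB; apply: (@integrable_mul_bounded _ _ _ _ 1).
- exact: measurable_avg.
- by move=> x; rewrite ger0_norm ?avg_ge0// avg_le1.
- exact: integrable_indicR.
Qed.

Lemma integrable_indic_heat a (A : set (space3 R)) (g : space3 R -> R) :
  0 < a -> measurable A -> (mu3 A < +oo)%E -> measurable_fun setT g ->
  mu3.-integrable setT (EFin \o (fun x => g x ^+ 2)) ->
  (prodm mu3 mu3).-integrable setT
    (EFin \o (fun z : space3 R * space3 R => \1_A z.1 * (g z.2 * heat a z.2 z.1))).
Proof.
move=> a0 mA Aoo mg gi.
have mf := @measurable_fst _ _ (space3 R) (space3 R).
have ms := @measurable_snd _ _ (space3 R) (space3 R).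
have gh y : mu3.-integrable setT (EFin \o (fun x => g x * heat a x y)).
  apply: integrable_mul_sqr => //; first exact: measurable_kernelr.
  exact: integrable_kernel_sqr.
set P := Num.sqrt (pi / a) ^+ 3.
apply: (@integrable_prod_abs _ _ _ _ _ _ _ _
  (fun y => (1 + P * \int[mu3]_x (g x ^+ 2)) * \1_A y)).
- apply: measurable_funM; first exact: (measurableT_comp (measurable_indic mA) mf).
  apply: measurable_funM; first exact: (measurableT_comp mg ms).
  under eq_fun do rewrite heatC; exact: measurable_heat.
- by move=> y; exact: (integrable_scale (\1_A y) (gh y)).
- move=> y /=.
  have -> : \int[mu3]_x `|\1_A y * (g x * heat a x y)| =
      \1_A y * \int[mu3]_x `|g x * heat a x y|.
    rewrite -RintegralZl//; last exact: (integrable_normr (gh y)).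
    by apply: eq_Rintegral => x _; rewrite normrM ger0_norm// indic_ge0.
  rewrite mulrC ler_wpM2r ?indic_ge0//.
  rewrite -(Rintegral_heat y a0) -RintegralZl// -RintegralD//; last 2 first.
  + exact: integrable_heat.
  + exact: integrable_scale.
  apply: le_Rintegral => //; first exact: (integrable_normr (gh y)).
    by apply: integrable_add; [exact: integrable_heat|exact: integrable_scale].
  move=> x _; rewrite normrM (ger0_norm (heat_ge0 _ _ _)).
  have g1 : `|g x| <= 1 + g x ^+ 2.
    rewrite -(real_normK (num_real (g x))).
    by have := sqr_ge0 (`|g x| - 1); have := normr_ge0 (g x); lra.
  apply: (le_trans (ler_wpM2r (heat_ge0 a x y) g1)).
  rewrite mulrDl mul1r lerD2l mulrC ler_wpM2r ?sqr_ge0//.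
  exact: heat_le.
- apply: integrable_scale; exact: integrable_indicR.
Qed.

Lemma Rintegral_indic_heat_swap a (A : set (space3 R)) (g : space3 R -> R) :
  0 < a -> measurable A -> (mu3 A < +oo)%E -> measurable_fun setT g ->
  mu3.-integrable setT (EFin \o (fun x => g x ^+ 2)) ->
  \int[mu3]_x (g x * avg a A x) =
  \int[mu3]_y (\1_A y * \int[mu3]_x (g x * heat a x y)).
Proof.
move=> a0 mA Aoo mg gi; have fi := integrable_indic_heat a0 mA Aoo mg gi.
have := Fubini_real fi => /=.
have gh y : mu3.-integrable setT (EFin \o (fun x => g x * heat a x y)).
  apply: integrable_mul_sqr => //; first exact: measurable_kernelr.
  exact: integrable_kernel_sqr.
under eq_Rintegral => y _ do rewrite (RintegralZl _ measurableT (gh y)).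
move=> ->; apply: eq_Rintegral => x _; rewrite /avg -RintegralZl//; last first.
  exact: integrable_heat_indic.
by apply: eq_Rintegral => y _; rewrite heatC; ring.
Qed.

Lemma indic_sqr B x : (\1_B x : R) ^+ 2 = \1_B x.
Proof. by rewrite indicE; case: (x \in B); rewrite ?expr1n ?expr0n. Qed.

Lemma integrable_indic_sqr B : measurable B -> (mu3 B < +oo)%E ->
  mu3.-integrable setT (EFin \o (fun x => (\1_B x : R) ^+ 2)).
Proof.
move=> mB Boo; under eq_fun do rewrite indic_sqr; exact: integrable_indicR.
Qed.

Lemma Rintegral_avg_sym a A B : 0 < a -> measurable A -> (mu3 A < +oo)%E ->
  measurable B -> (mu3 B < +oo)%E ->
  \int[mu3]_x (\1_B x * avg a A x) = \int[mu3]_x (\1_A x * avg a B x).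
Proof.
move=> a0 mA Aoo mB Boo; rewrite (Rintegral_indic_heat_swap a0 mA Aoo
  (measurable_indic mB) (integrable_indic_sqr mB Boo)).
apply: eq_Rintegral => y _; congr (_ * _); apply: eq_Rintegral => x _.
by rewrite mulrC.
Qed.

Lemma regular_overlap_cvg E B : measurable E -> (mu3 E < +oo)%E -> regular B ->
  \int[mu3]_x (\1_E x * avg n.+1%:R^-1 B x) @[n --> \oo] -->
  \int[mu3]_x (\1_E x * \1_B x : R).
Proof.
move=> mE Eoo [mB rB].
have a0 n : 0 < n.+1%:R^-1 :> R by rewrite invr_gt0 ltr0n.
have iEB : mu3.-integrable setT (EFin \o (fun x => \1_E x * \1_B x : R)).
  apply: (@integrable_mul_bounded _ _ _ _ 1).
  - exact: measurable_indic.
  - exact: norm_indic_le1.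
  - exact: integrable_indicR.
apply: fine_cvg; rewrite EFin_Rintegral//.
have := @dominated_convergence _ _ _ mu3 setT measurableT
  (fun n x => (\1_E x * avg n.+1%:R^-1 B x)%:E)
  (fun x => (\1_E x * \1_B x)%:E) (EFin \o (\1_E : space3 R -> R)).
case => //.
- move=> n; apply/measurable_EFinP; apply: measurable_funM => //.
  exact: measurable_avg.
- by apply/measurable_EFinP; exact: (integrable_measurable iEB).
- apply: filterS rB => x rx _; apply: cvg_EFin; first exact: nearW.
  by apply: cvgMr; exact: avg_cvg.
- exact: integrable_indicR.
- apply: aeW => x n _ /=; rewrite lee_fin normrM (ger0_norm (indic_ge0 _ _)).
  by rewrite ler_piMr ?indic_ge0// ger0_norm ?avg_ge0// avg_le1.
Qed.

(** By symmetry of the heat kernel, the overlap of E and B is also the integral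
    over B of a function between 0 and 1. As a function of B it is therefore
    dominated by the measure, and its limit, known on regular sets by dominated
    convergence, is known on all sets, in particular on E itself. The bounded
    set Q makes the dominating measure finite. *)
Lemma overlap_cvg E Q : measurable E -> E `<=` Q -> regular Q ->
  (mu3 Q < +oo)%E ->
  \int[mu3]_x (\1_E x * avg n.+1%:R^-1 E x) @[n --> \oo] --> fine (mu3 E).
Proof.
move=> mE EQ rQ Qoo; have [mQ _] := rQ.
have Eoo : (mu3 E < +oo)%E.
  by apply: le_lt_trans Qoo; apply: le_measure; rewrite ?inE.
have a0 n : 0 < n.+1%:R^-1 :> R by rewrite invr_gt0 ltr0n.
pose L n B := \int[mu3]_x (\1_E x * avg n.+1%:R^-1 (B `&` Q) x).
pose l B := \int[mu3]_x (\1_E x * \1_(B `&` Q) x : R).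
have fin B : measurable B -> (mu3 (B `&` Q) < +oo)%E.
  move=> mB; apply: le_lt_trans Qoo; apply: le_measure; rewrite ?inE//.
  exact: measurableI.
have iEB B : measurable B ->
    mu3.-integrable setT (EFin \o (fun x => \1_E x * \1_B x : R)).
  move=> mB; apply: (@integrable_mul_bounded _ _ _ _ 1).
  - exact: measurable_indic.
  - exact: norm_indic_le1.
  - exact: integrable_indicR.
have disjQ A B : A `&` B = set0 -> (A `&` Q) `&` (B `&` Q) = set0.
  by move=> AB; rewrite setIACA AB set0I.
have lE : fine (mu3 E) = l E.
  rewrite -Rintegral_indic// /l (setIidl EQ).
  by apply: eq_Rintegral => x _; rewrite -expr2 indic_sqr.
have LE n : \int[mu3]_x (\1_E x * avg n.+1%:R^-1 E x) = L n E.
  by rewrite /L (setIidl EQ).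
rewrite lE; under eq_fun do rewrite LE.
apply: (@dominated_setwise_cvg _ _ _ (mrestr mu3 mQ) (@regular R) L l) => //.
- by rewrite -[ltLHS]/(mu3 (setT `&` Q)) setTI.
- exact: measurable_regularE.
- exact: regular_setI_closed.
- move=> n A B mA mB AB; rewrite /L setIUl -RintegralD//; last 2 first.
  + by apply: integrable_indic_avg => //; exact: measurableI.
  + by apply: integrable_indic_avg => //; exact: measurableI.
  apply: eq_Rintegral => x _; rewrite avgU ?mulrDr//; try exact: measurableI.
  exact: disjQ.
- move=> A B mA mB AB; rewrite /l setIUl -RintegralD//; last 2 first.
  + by apply: iEB; exact: measurableI.
  + by apply: iEB; exact: measurableI.
  apply: eq_Rintegral => x _; rewrite -mulrDr; congr (_ * _).
  exact: indicU_disjoint (disjQ _ _ AB).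
- move=> n B mB; rewrite -[X in fine X]/(mu3 (B `&` Q)).
  have mBQ : measurable (B `&` Q) by exact: measurableI.
  rewrite /L (Rintegral_avg_sym (a0 n) mBQ (fin _ mB) mE Eoo).
  rewrite -Rintegral_indic//; apply/andP; split.
    by apply: Rintegral_ge0 => x _; rewrite mulr_ge0 ?indic_ge0 ?avg_ge0.
  apply: le_Rintegral => //.
  + exact: (integrable_indic_avg (a0 n) mBQ (fin _ mB) mE).
  + exact: (integrable_indicR mBQ (fin _ mB)).
  + by move=> x _; rewrite ler_piMr ?indic_ge0// avg_le1.
- move=> B mB; rewrite -[X in fine X]/(mu3 (B `&` Q)).
  have mBQ : measurable (B `&` Q) by exact: measurableI.
  rewrite -Rintegral_indic//; apply/andP; split.
    by apply: Rintegral_ge0 => x _; rewrite mulr_ge0 ?indic_ge0.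
  apply: le_Rintegral => //; first exact: iEB.
    exact: (integrable_indicR mBQ (fin _ mB)).
  by move=> x _; rewrite mulrC ler_piMr ?indic_ge0.
- apply: regular_overlap_cvg => //; rewrite setTI//.
- by move=> B rB; apply: regular_overlap_cvg => //; exact: regularI.
Qed.

End heat_overlap.

Section heat_bound_ae.
Variable R : realType.
Notation leb := (@lebesgue_measure R).
Notation mu3 := (mu3 R).
Implicit Types (x y : space3 R) (a : R) (E Q Z : set (space3 R)).
Implicit Types (g : space3 R -> R).

(** The heat flow preserves mass. *)
Lemma integral_avg a E : 0 < a -> measurable E ->
  (\int[mu3]_x (avg a E x)%:E = mu3 E)%E.
Proof.
move=> a0 mE; have ms := @measurable_snd _ _ (space3 R) (space3 R).
transitivity (\int[mu3]_x \int[mu3]_y (heat a y x * \1_E y)%:E)%E.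
  apply: eq_integral => x _; rewrite /avg EFin_Rintegral//.
  exact: integrable_heat_indic.
have mf : measurable_fun setT
    (fun z : space3 R * space3 R => (heat a z.2 z.1 * \1_E z.2)%:E).
  apply/measurable_EFinP; apply: measurable_funM.
    under eq_fun do rewrite heatC; exact: measurable_heat.
  exact: (measurableT_comp (measurable_indic mE) ms).
rewrite (fubini_tonelli (fun z : space3 R * space3 R =>
  (heat a z.2 z.1 * \1_E z.2)%:E)) //=; last first.
  by move=> z; rewrite lee_fin mulr_ge0 ?heat_ge0 ?indic_ge0.
transitivity (\int[mu3]_y (\1_E y : R)%:E)%E; last first.
  by rewrite integral_indic// setIT.
apply: eq_integral => y _; have ih := integrable_heat y a0.
transitivity (\int[mu3]_x (\1_E y * heat a x y)%:E)%E.
  by apply: eq_integral => x _; rewrite heatC mulrC.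
rewrite -EFin_Rintegral; last exact: integrable_scale.
by rewrite RintegralZl// Rintegral_heat// mulr1.
Qed.

Lemma integrable_avg a E : 0 < a -> measurable E -> (mu3 E < +oo)%E ->
  mu3.-integrable setT (EFin \o avg a E).
Proof.
move=> a0 mE Eoo; apply: ge0_integrable; first exact: measurable_avg.
  by move=> x; exact: avg_ge0.
by rewrite integral_avg.
Qed.

(** Both functions take values in [0, 1] and have the same integral, so their
    squares are controlled by their integrals and only the overlap remains. *)
Lemma avg_sqr_distance a E : 0 < a -> measurable E -> (mu3 E < +oo)%E ->
  mu3.-integrable setT (EFin \o (fun x => (avg a E x - \1_E x) ^+ 2)) /\
  \int[mu3]_x ((avg a E x - \1_E x) ^+ 2) <=
  2 * (fine (mu3 E) - \int[mu3]_x (\1_E x * avg a E x)).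
Proof.
move=> a0 mE Eoo; have ma := measurable_avg a mE.
have iE := integrable_indicR mE Eoo.
have iEa := integrable_indic_avg a0 mE Eoo mE.
have h01 x : 0 <= avg a E x <= 1 by rewrite avg_ge0 avg_le1.
have ia := integrable_avg a0 mE Eoo.
have Ia : \int[mu3]_x avg a E x = fine (mu3 E).
  by rewrite /Rintegral integral_avg.
pose D x := avg a E x - 2 * (\1_E x * avg a E x) + \1_E x.
have iD : mu3.-integrable setT (EFin \o D).
  by apply: integrable_add => //; apply: integrable_sub => //;
    exact: integrable_scale.
have sq_le x : (avg a E x - \1_E x) ^+ 2 <= D x.
  have /andP[h0 h1] := h01 x; have e2 := indic_sqr E x.
  have h2 : avg a E x ^+ 2 <= avg a E x by rewrite expr2 ler_piMl.
  by rewrite /D; lra.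
have mS : measurable_fun setT (fun x => (avg a E x - \1_E x) ^+ 2).
  by apply: measurable_funX; exact: measurable_funB.
have iS : mu3.-integrable setT (EFin \o (fun x => (avg a E x - \1_E x) ^+ 2)).
  by apply: le_integrableR mS _ iD => x; rewrite ger0_norm ?sqr_ge0.
split => //; apply: (@le_trans _ _ (\int[mu3]_x D x)).
  by apply: le_Rintegral.
rewrite /D RintegralD//; last by apply: integrable_sub => //; exact: integrable_scale.
rewrite RintegralB//; last exact: integrable_scale.
rewrite RintegralZl// Ia Rintegral_indic//; lra.
Qed.

(** By Fubini the bound holds for the heat averages of E in place of its
    indicator; these converge to the indicator in L2. *)
Lemma Rintegral_indic_le E Q g B : measurable E -> E `<=` Q -> regular Q ->
  (mu3 Q < +oo)%E -> measurable_fun setT g ->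
  mu3.-integrable setT (EFin \o (fun x => g x ^+ 2)) ->
  (forall a y, 0 < a -> E y -> \int[mu3]_x (g x * heat a x y) <= B) ->
  \int[mu3]_x (g x * \1_E x) <= B * fine (mu3 E).
Proof.
move=> mE EQ rQ Qoo mg gi hB; have [mQ _] := rQ.
have Eoo : (mu3 E < +oo)%E.
  by apply: le_lt_trans Qoo; apply: le_measure; rewrite ?inE.
have a0 n : 0 < n.+1%:R^-1 :> R by rewrite invr_gt0 ltr0n.
have iE2 := integrable_indic_sqr mE Eoo.
have iavg n : mu3.-integrable setT
    (EFin \o (fun x => avg n.+1%:R^-1 E x ^+ 2)).
  apply: le_integrableR (integrable_avg (a0 n) mE Eoo).
    by apply: measurable_funX; exact: measurable_avg.
  move=> x; rewrite ger0_norm ?sqr_ge0// expr2.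
  by rewrite ler_piMl ?avg_ge0// avg_le1.
have ub n : \int[mu3]_x (g x * avg n.+1%:R^-1 E x) <= B * fine (mu3 E).
  rewrite (Rintegral_indic_heat_swap (a0 n) mE Eoo mg gi).
  rewrite -Rintegral_indic// -RintegralZl//; last exact: integrable_indicR.
  have gh y : mu3.-integrable setT
      (EFin \o (fun x => g x * heat n.+1%:R^-1 x y)).
    apply: integrable_mul_sqr => //; first exact: measurable_kernelr.
    exact: integrable_kernel_sqr.
  apply: le_Rintegral => //.
  - have := integrable_fubini_real
      (integrable_indic_heat (a0 n) mE Eoo mg gi).
    congr integrable; apply/funext => y /=.
    by rewrite (RintegralZl _ measurableT (gh y)).
  - exact/integrable_scale/integrable_indicR.
  - move=> y _; rewrite mulrC indicE.
    have [yE|yE] := boolP (y \in E); last by rewrite !mulr0.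
    by rewrite !mulr1; apply: hB => //; exact/set_mem.
set I := \int[mu3]_x (g x * \1_E x).
pose J n := \int[mu3]_x (g x * avg n.+1%:R^-1 E x).
have JI n : (J n - I) ^+ 2 <= \int[mu3]_x (g x ^+ 2) *
    (2 * (fine (mu3 E) - \int[mu3]_x (\1_E x * avg n.+1%:R^-1 E x))).
  have [i1 i2] := avg_sqr_distance (a0 n) mE Eoo.
  have mD : measurable_fun setT (fun x => avg n.+1%:R^-1 E x - \1_E x).
    by apply: measurable_funB => //; exact: measurable_avg.
  rewrite /J /I -RintegralB//; last 2 first.
  - by apply: integrable_mul_sqr => //; exact: measurable_avg.
  - by apply: integrable_mul_sqr.
  under eq_Rintegral do rewrite -mulrBr.
  apply: (le_trans (Rintegral_cauchy_schwarz mg mD gi i1)).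
  by apply: ler_wpM2l => //; apply: Rintegral_ge0 => x _; exact: sqr_ge0.
have cJ2 : (J n - I) ^+ 2 @[n --> \oo] --> (0 : R).
  set G2 := \int[mu3]_x (g x ^+ 2) in JI.
  have Nc : G2 * (2 * (fine (mu3 E) -
      \int[mu3]_x (\1_E x * avg n.+1%:R^-1 E x))) @[n --> \oo] --> (0 : R).
    rewrite -(mulr0 G2) -(mulr0 2) -(subrr (fine (mu3 E))).
    apply: cvgMr; apply: cvgMr; apply: cvgB; first exact: cvg_cst.
    exact: overlap_cvg EQ rQ Qoo.
  apply: (@squeeze_cvgr _ _ _ _ (cst 0) _ _ _ _ _ Nc); last exact: cvg_cst.
  by apply: nearW => n; rewrite sqr_ge0 JI.
rewrite leNgt; apply/negP => lt.
have e0 : 0 < (I - B * fine (mu3 E)) ^+ 2 by rewrite exprn_gt0// subr_gt0.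
have /cvgrPdist_lt /(_ _ e0)[N _ /(_ N (leqnn N))] := cJ2.
rewrite /= sub0r normrN ger0_norm ?sqr_ge0// ltNge => /negP; apply.
have JN : J N <= B * fine (mu3 E) := ub N.
rewrite -[leRHS]sqrrN opprB; apply: lerXn2r; rewrite ?nnegrE; lra.
Qed.

Definition cube (m : nat) : set (space3 R) :=
  (`]- m%:R, m%:R] `*` `]- m%:R, m%:R]) `*` `]- m%:R, m%:R].

Lemma cube_lty m : (mu3 (cube m) < +oo)%E.
Proof.
rewrite /cube mu3E// lebesgue_measure_itv/= lte_fin.
by case: ifP => _; rewrite ?mule0 ?lteey// -EFinD -!EFinM ltry.
Qed.

Lemma regular_cube m : regular (cube m).
Proof.
have E (p : space3 R -> R) : (forall b, regular [set x | p x <= b]) ->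
    regular (p @^-1` `]- m%:R, m%:R]).
  move=> rp.
  rewrite (_ : _ @^-1` _ = [set x | p x <= m%:R] `&` ~` [set x | p x <= - m%:R]).
    by apply: regularI => //; exact: regularC.
  apply/seteqP; split => x /=; rewrite in_itv/=.
    by move=> /andP[h1 h2]; split => //; apply/negP; rewrite -ltNge.
  by move=> [h1 /negP]; rewrite -ltNge h1 => ->.
exact: (regularI (regularI (E _ (@regular_ray1 R)) (E _ (@regular_ray2 R)))
  (E _ (@regular_ray3 R))).
Qed.

Lemma cube_exhaust x : exists m, cube m x.
Proof.
set s := `|x.1.1| + `|x.1.2| + `|x.2|.
have := archi_boundP (_ : 0 <= s); rewrite !addr_ge0// => /(_ isT).
set m := Num.bound s => sm; exists m.
have h1 := normr_ge0 x.1.1; have h2 := normr_ge0 x.1.2.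
have h3 := normr_ge0 x.2.
have itv (u : R) : `|u| < m%:R -> `]- m%:R, m%:R]%classic u.
  by rewrite ltr_norml /= in_itv/= => /andP[-> /ltW ->].
by split; [split|]; apply: itv; rewrite /s in sm; lra.
Qed.

(** On a bounded part of the subset of Z where g exceeds B, the integral of
    g - B is at most 0, so that this part is negligible. *)
Lemma heat_bound_ae Z g B : measurable Z -> measurable_fun setT g ->
  mu3.-integrable setT (EFin \o (fun x => g x ^+ 2)) ->
  (forall a y, 0 < a -> Z y -> \int[mu3]_x (g x * heat a x y) <= B) ->
  {ae mu3, forall x, Z x -> g x <= B}.
Proof.
move=> mZ mg gi hB.
pose E m := Z `&` [set x | B < g x] `&` cube m.
have mE m : measurable (E m).
  have [mc _] := regular_cube m; apply: measurableI => //; apply: measurableI => //.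
  rewrite (_ : [set x | B < g x] = setT `&` g @^-1` `]B, +oo[%classic).
    exact: mg.
  by apply/seteqP; split => x /=; rewrite in_itv/= andbT; tauto.
suff nE m : {ae mu3, forall x, ~ E m x}.
  have /ae_foralln : forall m, {ae mu3, forall x, ~ E m x} by [].
  apply: filterS => x nx Zx; rewrite leNgt; apply/negP => Bg.
  by have [m cx] := cube_exhaust x; apply: (nx m).
have Eoo : (mu3 (E m) < +oo)%E.
  apply: le_lt_trans (cube_lty m); apply: le_measure; rewrite ?inE//.
    by have [] := regular_cube m.
  by move=> x [].
have iE := integrable_indicR (mE m) Eoo.
have igE : mu3.-integrable setT (EFin \o (fun x => g x * \1_(E m) x)).
  by apply: integrable_mul_sqr => //; exact: integrable_indic_sqr.
pose D x := g x * \1_(E m) x - B * \1_(E m) x.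
have iD : mu3.-integrable setT (EFin \o D).
  by apply: integrable_sub => //; exact: integrable_scale.
have DE x : D x = (g x - B) * \1_(E m) x by rewrite /D mulrBl.
have D0 x : 0 <= D x.
  rewrite DE indicE; have [/set_mem[[_ Bg] _]|_] := boolP (x \in E m).
    by rewrite mulr1 subr_ge0 ltW.
  by rewrite mulr0.
have ID : \int[mu3]_x D x <= 0.
  rewrite /D RintegralB//; last exact: integrable_scale.
  rewrite RintegralZl// Rintegral_indic// subr_le0.
  apply: Rintegral_indic_le (regular_cube m) (cube_lty m) _ _ _ => //.
    by move=> x [].
  by move=> a y a0 [[Zy _] _]; exact: hB.
have : (\int[mu3]_x `|(EFin \o D) x| = 0)%E.
  under eq_integral => x _ do rewrite /= (ger0_norm (D0 x)).
  rewrite -EFin_Rintegral//; congr EFin; apply/eqP; rewrite eq_le ID/=.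
  by apply: Rintegral_ge0 => x _.
move=> /(ae_eq_integral_abs mu3 measurableT (measurable_int _ iD)).1.
apply: filterS => x /(_ I) [Dx] Ex; move: Dx; rewrite DE indicE mem_set//.
rewrite mulr1; case: Ex => -[_ Bg] _ /eqP.
by rewrite subr_eq0 => /eqP gB; rewrite /= gB ltxx in Bg.
Qed.

End heat_bound_ae.

(** * Assembling the estimate *)

Section off_diagonal_estimate.
Variable R : realType.
Notation mu3 := (mu3 R).
Implicit Types (x y : space3 R) (f g h : space3 R -> R[i]).

(** The reverse triangle inequality in the plane; the third coordinate can
    only increase the distance. *)
Lemma norm_bar_separation x y (D : R) : 0 <= D ->
  D <= norm_bar x - norm_bar y -> D ^+ 2 <= nsq (x - y)%R.
Proof.
move=> D0 Dxy.
have sq (z : space3 R) : norm_bar z ^+ 2 = z.1.1 ^+ 2 + z.1.2 ^+ 2.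
  by rewrite sqr_sqrtr// addr_ge0 ?sqr_ge0.
have X0 : 0 <= norm_bar x by exact: sqrtr_ge0.
have Y0 : 0 <= norm_bar y by exact: sqrtr_ge0.
have CS : x.1.1 * y.1.1 + x.1.2 * y.1.2 <= norm_bar x * norm_bar y.
  rewrite (le_trans (ler_norm _))// -(ger0_norm (mulr_ge0 X0 Y0)).
  rewrite -ler_sqr ?nnegrE// !real_normK ?num_real// exprMn !sq.
  have := sqr_ge0 (x.1.1 * y.1.2 - x.1.2 * y.1.1).
  by move=> ?; lra.
apply: (@le_trans _ _ ((norm_bar x - norm_bar y) ^+ 2)).
  by apply: lerXn2r; rewrite ?nnegrE// (le_trans D0).
have := sqr_ge0 (x.2 - y.2); rewrite /nsq /= => h3.
by rewrite sqrrB !sq; lra.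
Qed.

Lemma measurable_norm_bar : measurable_fun setT (@norm_bar R).
Proof.
apply: (@measurableT_comp _ _ _ _ _ _ (@Num.sqrt R)).
  by apply: continuous_measurable_fun => u; exact: sqrt_continuous.
by apply: measurable_funD; apply: measurable_funX;
  [exact: measurable_coord1|exact: measurable_coord2].
Qed.

Lemma measurable_cylinder (rho : R) :
  measurable [set x : space3 R | norm_bar x <= rho].
Proof.
rewrite (_ : [set x | _] = setT `&` (@norm_bar R) @^-1` `]-oo, rho]%classic).
  exact: measurable_norm_bar.
by apply/seteqP; split => x /=; rewrite in_itv/=; tauto.
Qed.

Lemma cmod_mul_conj (z w : R[i]) : cmod (z * (w^*)%C) = cmod z * cmod w.
Proof.
by case: z w => [a b] [c e]; rewrite ComplexField.Normc.normcM !cmodE /= sqrrN.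
Qed.

Lemma riesz4_bounded_ae (i : 'I_3) f h (Z : set (space3 R)) (c : R) :
  0 < c -> measurable Z -> inLp 1 f -> is_riesz4 i f h ->
  (forall y, Z y -> {ae mu3, forall x, f x = 0 \/
    2 * c <= (2 * pi) ^+ 2 * nsq (x - y)%R}) ->
  {ae mu3, forall x, Z x -> cmod (h x) <=
    2 * (kernel_const c / c * \int[mu3]_x cmod (f x))}.
Proof.
move=> c0 mZ f1 fh sep.
have [_ [H [_ [h2 _ _] _]]] := fh; have [hm1 hm2 _] := h2.
set B := kernel_const c / c * _.
have hrot phi : {ae mu3, forall x, Z x -> rot (- phi) (h x) <= B}.
  apply: heat_bound_ae => //.
  - exact: (measurable_rot (conj hm1 hm2) (measurable_cst _)).
  - exact: (integrable_rot_sqr (conj hm1 hm2) (measurable_cst _)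
      (inL2_integrable h2)).
  - move=> a y a0 Zy; apply: (le_trans (ler_norm _)).
    exact: (riesz4_heat_bound phi a0 c0 f1 fh (sep y Zy)).
(* two opposite directions for each of the real and the imaginary part *)
have hRe : {ae mu3, forall x, Z x -> `|complex.Re (h x)| <= B}.
  apply: filterS2 (hrot 0) (hrot pi) => x k1 k2 Zx.
  have := k1 Zx; have := k2 Zx.
  rewrite /rot !cosN !sinN cos0 sin0 cospi sinpi => h3 h4.
  by rewrite ler_norml; apply/andP; split; lra.
have hIm : {ae mu3, forall x, Z x -> `|complex.Im (h x)| <= B}.
  apply: filterS2 (hrot (pi / 2)) (hrot (- (pi / 2))) => x k1 k2 Zx.
  have := k1 Zx; have := k2 Zx.
  rewrite /rot opprK cosN sinN cos_pihalf sin_pihalf => h3 h4.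
  by rewrite ler_norml; apply/andP; split; lra.
apply: filterS2 hRe hIm => x k1 k2 Zx; apply: (le_trans (cmod_le_ReIm _)).
by rewrite mulr_natl mulr2n lerD ?k1 ?k2.
Qed.

End off_diagonal_estimate.

(* r is the radius parameter (R in the source). The kernel of R_i^4 is
   homogeneous of degree -3, so by scaling the optimal bound is of order
   r^-3: a bound by r^-1 with a constant uniform in r holds for r bounded
   away from 0, and r0 is an arbitrary such lower bound. *)
Theorem proposition2p4 (R : realType) (d r0 : R) (d_gt0 : 0 < d)
    (r0_gt0 : 0 < r0) :
  exists2 C : R, 0 < C &
  forall (i : 'I_3) (gamma1 gamma2 r : R) (f g h : space3 R -> R[i]),
    0 < gamma1 -> 0 < gamma2 -> gamma2 - gamma1 = d ->
    r0 <= r ->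
    inLp 1 f -> inLp 2 f -> inLp 1 g -> inLp 2 g ->
    supported_in [set x | gamma2 * r <= norm_bar x] f ->
    supported_in [set x | norm_bar x <= gamma1 * r] g ->
    is_riesz4 i f h ->
    ((cmod (innerL2 h g))%:E <= (C * r^-1)%:E * normLp 1 g * normLp 1 f)%E.
Proof.
have p0 := pi_gt0 R.
(* points of the two supports are at distance at least d r, and D r ^+ 2 is the
   parameter c of the kernel bound for this distance *)
pose D : R := 2 * pi ^+ 2 * d ^+ 2.
have D0 : 0 < D by rewrite /D !(mulr_gt0, exprn_gt0).
(* kernel_const c / c is of order r ^- 3, two powers of which are traded for
   powers of r0 *)
pose K : R := 3 * 10 ^+ 5 * pi * Num.sqrt (pi / D) / (D * r0 ^+ 2).
have K0 : 0 < K.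
  have s0 : 0 < Num.sqrt (pi / D) by rewrite sqrtr_gt0 divr_gt0.
  have rr0 : 0 < r0 ^+ 2 by rewrite exprn_gt0.
  have t0 : 0 < 10 ^+ 5 :> R by rewrite exprn_gt0.
  by rewrite /K divr_gt0// !mulr_gt0.
exists (4 * K) => [|i gamma1 gamma2 r f g h g1_gt0 g2_gt0 gd r0r f1 f2 g1 g2 sf sg fh].
  by rewrite mulr_gt0.
have r_gt0 : 0 < r by rewrite (lt_le_trans r0_gt0).
pose c := D * r ^+ 2.
have c0 : 0 < c by rewrite mulr_gt0// exprn_gt0.
have Kc : kernel_const c / c <= K * r^-1.
  have r2 : r0 ^+ 2 <= r ^+ 2 by apply: lerXn2r => //; rewrite nnegrE ltW.
  have sE : Num.sqrt (pi / c) = Num.sqrt (pi / D) * r^-1.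
    have -> : pi / c = pi / D * (r^-1) ^+ 2.
      by rewrite /c invfM exprVn mulrA.
    rewrite sqrtrM ?divr_ge0 ?(ltW p0) ?(ltW D0)// sqrtr_sqr ger0_norm//.
    by rewrite invr_ge0 ltW.
  have -> : kernel_const c = 3 * 10 ^+ 5 * pi * Num.sqrt (pi / D) * r^-1.
    by rewrite /kernel_const sE mulrA.
  rewrite /K [leRHS]mulrAC; apply: ler_wpM2l.
    by rewrite !mulr_ge0 ?exprn_ge0 ?sqrtr_ge0 ?invr_ge0 ?(ltW p0) ?(ltW r_gt0).
  have Dr0 : 0 < D * r0 ^+ 2 by rewrite mulr_gt0// exprn_gt0.
  by rewrite lef_pV2 ?posrE//; apply: ler_wpM2l => //; exact: ltW.
pose Z := [set x : space3 R | norm_bar x <= gamma1 * r].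
have sep y : Z y -> {ae mu3 R, forall x, f x = 0 \/
    2 * c <= (2 * pi) ^+ 2 * nsq (x - y)%R}.
  move=> Zy; apply: filterS sf => x sfx.
  have [gx|gx] := pselect (gamma2 * r <= norm_bar x); last by left; exact: sfx.
  right; have dr : (d * r) ^+ 2 <= nsq (x - y)%R.
    apply: norm_bar_separation; first by rewrite mulr_ge0 ?ltW.
    by rewrite -gd mulrBl lerB.
  rewrite (_ : 2 * c = (2 * pi) ^+ 2 * (d * r) ^+ 2).
    by rewrite ler_wpM2l// sqr_ge0.
  by rewrite /c /D; move: (pi : R) => p; ring.
set Nf := \int[mu3 R]_x cmod (f x).
have Nf0 : 0 <= Nf by apply: Rintegral_ge0 => x _; exact: cmod_ge0.
set Ng := \int[mu3 R]_x cmod (g x).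
have Ng0 : 0 <= Ng by apply: Rintegral_ge0 => x _; exact: cmod_ge0.
have hB := riesz4_bounded_ae c0 (@measurable_cylinder R _) f1 fh sep.
have [_ [H [_ [[hm1 hm2 _] _ _] _]]] := fh; have [gm1 gm2 _] := g1.
pose B := 2 * (kernel_const c / c * Nf).
pose k x := h x * ((g x)^*)%C.
have kB : {ae mu3 R, forall x, cmod (k x) <= B * cmod (g x)}.
  apply: filterS2 hB sg => x hx gx; rewrite /k cmod_mul_conj.
  have [Zx|Zx] := pselect (Z x).
    by apply: ler_wpM2r; [exact: cmod_ge0|exact: hx].
  by rewrite gx// cmodE/= expr0n/= addr0 sqrtr0 !mulr0.
have mk1 : measurable_fun setT (fun x => complex.Re (k x)).
  rewrite (_ : (fun x => _) = fun x => complex.Re (h x) * complex.Re (g x) +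
      complex.Im (h x) * complex.Im (g x)).
    by apply: measurable_funD; apply: measurable_funM.
  apply/funext => x; rewrite /k; case: (h x) (g x) => [a b] [u v] /=; ring.
have mk2 : measurable_fun setT (fun x => complex.Im (k x)).
  rewrite (_ : (fun x => _) = fun x => complex.Im (h x) * complex.Re (g x) -
      complex.Re (h x) * complex.Im (g x)).
    by apply: measurable_funB; apply: measurable_funM.
  apply/funext => x; rewrite /k; case: (h x) (g x) => [a b] [u v] /=; ring.
have ig : (mu3 R).-integrable setT (EFin \o (fun x => B * cmod (g x))).
  exact/integrable_scale/inL1_integrable.
have BNg : \int[mu3 R]_x (B * cmod (g x)) = B * Ng.
  by rewrite RintegralZl//; exact: inL1_integrable.
have kRe : {ae mu3 R, forall x, `|complex.Re (k x)| <= B * cmod (g x)}.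
  by apply: filterS kB => x; apply: le_trans; exact: norm_Re_le.
have kIm : {ae mu3 R, forall x, `|complex.Im (k x)| <= B * cmod (g x)}.
  by apply: filterS kB => x; apply: le_trans; exact: norm_Im_le.
have [_ k1] := ae_ler_norm_Rintegral mk1 ig kRe.
have [_ k2] := ae_ler_norm_Rintegral mk2 ig kIm.
rewrite BNg in k1 k2.
rewrite (normL1_fin f1) (normL1_fin g1) -!EFinM lee_fin -/Nf -/Ng.
apply: (le_trans (cmod_le_ReIm _)); rewrite /innerL2 /cint3/= leb3E -/(k _).
apply: (le_trans (lerD k1 k2)).
rewrite (_ : B * Ng + B * Ng = 4 * (kernel_const c / c) * (Ng * Nf)).
  rewrite -[leRHS]mulrA; apply: ler_wpM2r; first exact: mulr_ge0.
  by rewrite -[leRHS]mulrA ler_wpM2l.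
by rewrite /B; ring.
Qed.
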